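(* Let $T$ be a tree of diameter $4$ with unique central vertex $\mathtt{c}$ and vertices $v_1,\dots,v_n$, let $s_1,\dots,s_n\ge 2$ be integers, let $\mathcal{T}=T(s_1,\dots,s_n)$ be the corresponding vertex-multiplication, and let $s$ be the multiplicity assigned to $\mathtt{c}$. Suppose $s\ge 3$ is odd. With $A_j$, $A_{\ge j}$ and $\mathscr{C}_0$ as defined in the context, the following hold. (1) If $|A_2|=0$, $|A_3|\ge 1$ and $|A_{\ge 4}|\ge 0$, then $\mathcal{T}\in\mathscr{C}_0$ if and only if $|A_3|\le 2\binom{s}{\lceil s/2\rceil}-2$. (2) If $|A_2|=0$, $|A_3|=0$ and $|A_{\ge 4}|\ge 2$, then $\mathcal{T}\in\mathscr{C}_0$. (3) If $|A_2|\ge 2$, $|A_3|=0$ and $|A_{\ge 4}|=0$, then $\mathcal{T}\in\mathscr{C}_0$ if and only if: $|A_2|\le\binom{s}{\lceil s/2\rceil}-1$ in the case $|A_2|<\deg_T(\mathtt{c})$; $|A_2|\le\binom{s}{\lceil s/2\rceil}$ in the case $|A_2|=\deg_T(\mathtt{c})$. (4) If $|A_2|\ge 1$, $|A_3|=0$ and $|A_{\ge 4}|\ge 1$, then $\mathcal{T}\in\mathscr{C}_0$ if and only if $|A_2|\le\binom{s}{\lceil s/2\rceil}-1$. (5) If $|A_2|\ge 1$, $|A_3|=1$ and $|A_{\ge 4}|=0$, then $\mathcal{T}\in\mathscr{C}_0$ if and only if $|A_2|\le\binom{s}{\lceil s/2\rceil}-1$. (6) If $|A_2|\ge 1$, $|A_3|\ge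 2$ and $|A_{\ge 4}|=0$, then $\mathcal{T}\in\mathscr{C}_0$ if and only if at least one of the following holds: (i) $2|A_2|+|A_3|\le 2\binom{s}{\lceil s/2\rceil}-2$; (ii) $2|A_2|+|A_3|=2\binom{s}{\lceil s/2\rceil}-1$, $|A_2|\ge\lceil\frac{s}{2}\rceil\lfloor\frac{s}{2}\rfloor$ and $s\ge 5$. (7) If $|A_2|\ge 1$, $|A_3|=1$ and $|A_{\ge 4}|\ge 1$, then $\mathcal{T}\in\mathscr{C}_0$ if and only if $|A_2|\le\binom{s}{\lceil s/2\rceil}-2$. (8) If $|A_2|\ge 1$, $|A_3|\ge 2$ and $|A_{\ge 4}|\ge 1$, then $\mathcal{T}\in\mathscr{C}_0$ if and only if $2|A_2|+|A_3|\le 2\binom{s}{\lceil s/2\rceil}-2$.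
   Context: Graphs are finite and simple. For a connected graph $G$ with vertices $v_1,\dots,v_n$ and positive integers $s_1,\dots,s_n$, the vertex-multiplication $G(s_1,\dots,s_n)$ is the graph whose vertex set is the disjoint union of sets $V_i$ with $|V_i|=s_i$, where $u\in V_i$ and $w\in V_j$ are adjacent if and only if $i\ne j$ and $v_iv_j\in E(G)$. Throughout all $s_i\ge 2$. We write $s_v$ for the multiplicity of the vertex $v$. An orientation of a graph assigns one direction to every edge; it is strong if every two vertices are mutually reachable. The diameter $d(D)$ of a digraph $D$ is the maximum of the directed distances $d_D(u,w)$ over all ordered pairs. The orientation number $\bar d(H)$ of a connected bridgeless graph $H$ is the minimum of $d(D)$ over all strong orientations $D$ of $H$. $\mathscr{C}_0$ is the class of all vertex-multiplications $G(s_1,\dots,s_n)$ (all $s_i\ge2$) with $\bar d(G(s_1,\dots,s_n))=d(G)$; thus, for a tree $T$ of diameter $4$, $\mathcal{T}=T(s_1,\dots,s_n)\in\mathscr{C}_0$ means $\bar d(\mathcal{T})=4$. Let $T$ be a tree of diameter $4$ with unique central vertex $\mathtt{c}$ (the vertex of eccentricity $2$), and let $s=s_{\mathtt{c}}$. Denote the neighbours of $\mathtt{c}$ by $[i]$, $1\le i\le\deg_T(\mathtt{c})$. Let $E$ be the set of those $[i]$ that are leaves of $T$. For a positive integer $j$, $A_j=\{[i] : [i]\notin E,\ s_{[i]}=j\}$, and $A_{\ge j}=\{[i] : [i]\notin E,\ s_{[i]}\ge j\}$. *)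

(* Defs.v *)
From mathcomp Require Import all_boot.

Set Implicit Arguments.
Unset Strict Implicit.
Unset Printing Implicit Defensive.

Section Digraphs.
Variables (V : finType) (r : rel V).

Definition walk_of_length (k : nat) (x y : V) : bool :=
  [exists p : k.-tuple V, path r x p && (last x p == y)].

(* The least length of an r-walk from x to y; it is #|V|, a value no finite
   distance can take, when y is not reachable from x. *)
Definition dist (x y : V) : nat :=
  find (fun k => walk_of_length k x y) (iota 0 #|V|).

Definition ecc (x : V) : nat := \max_(y : V) dist x y.

Definition diam : nat := \max_(x : V) \max_(y : V) dist x y.

(* All vertices mutually reachable: strong connectivity of a digraph, and
   connectedness of a graph given by a symmetric relation. *)
Definition strong : bool := [forall x, forall y, connect r x y].

End Digraphs.

Section Graphs.
Variables (V : finType) (e : rel V).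

Definition simple_graph : Prop := symmetric e /\ irreflexive e.

(* For a simple graph, [ucycle e p] also holds when p is empty or is the two
   ends of an edge; these are not cycles of the graph. *)
Definition acyclic : Prop := forall p : seq V, ucycle e p -> size p <= 2.

Definition tree : Prop := [/\ simple_graph, strong e & acyclic].

Definition deg (v : V) : nat := #|[set w | e v w]|.

Definition arc (D : {set V * V}) : rel V := [rel x y | (x, y) \in D].

Definition orientation (D : {set V * V}) : bool :=
  [forall x, forall y,
     if e x y then arc D x y (+) arc D y x else ~~ arc D x y].

(* The minimum of the diameters of the strong orientations. The default
   #|V| is larger than the diameter of any strong digraph on V (V nonempty),
   so it does not affect the minimum; it is the value only when there is no
   strong orientation. *)
Definition orientation_number : nat :=
  \big[minn/#|V|]_(D : {set V * V} | orientation D && strong (arc D))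
     diam (arc D).

End Graphs.

Section VertexMultiplication.
Variables (V : finType) (e : rel V) (s : V -> nat).

Definition vmul_vertex : finType := {v : V & 'I_(s v)}.

Definition vmul : rel vmul_vertex :=
  [rel x y | (tag x != tag y) && e (tag x) (tag y)].

Definition in_C0 : Prop :=
  (forall v, 2 <= s v) /\ orientation_number vmul = diam e.

End VertexMultiplication.

Section NeighboursOfCentre.
Variables (V : finType) (e : rel V) (s : V -> nat) (c : V).

Definition leaf_nbrs : {set V} := [set v | e c v && (deg e v == 1)].

Definition A_eq (j : nat) : {set V} :=
  [set v | [&& e c v, v \notin leaf_nbrs & s v == j]].

Definition A_ge (j : nat) : {set V} :=
  [set v | [&& e c v, v \notin leaf_nbrs & j <= s v]].

End NeighboursOfCentre.

(* Main.v *)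
(** Put [s c = 2k+1], [C = 'C(2k+1, k)], [a = |A_2|], [b = |A_3|]. An orientation
    is governed by the out-sets, inside the class of the centre, of the copies
    of the neighbours of the centre. If a copy [x] of a leaf hangs below the
    neighbour [i], let [P_i] be the union of the out-sets of the out-neighbours
    of [x], and [Q_i] the intersection of the out-sets of its in-neighbours.
    Diameter 4 forces, for every copy [u] of a neighbour [j <> i], that [P_i] is
    not contained in the out-set of [u] and that this out-set is not contained
    in [Q_i]. Hence the [P_i] for which [x] has a single out-neighbour form an
    antichain, and so do the [Q_i] for which it has a single in-neighbour; a
    member of [A_2] counts in both families and a member of [A_3] in exactly
    one, whence [2a + b <= 2C] by Sperner's theorem. In the cases [2C - 1] and
    [2C] one antichain is a full middle layer and the other misses at most one
    set: such an antichain either lies in a middle layer or already dominates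
    every possible out-set. If it is a [k]-layer without one set [R], a member
    of [A_3] with [Q_i] in that layer needs [|R :|: Q_i| >= k+2], so the
    [k(k+1)] sets obtained from [R] by exchanging one element all belong to
    members of [A_2].

    Conversely, if [2a + b <= 2C - 2], a [k]-set [R] and its complement are kept
    out of both families and serve as out-sets for all the remaining copies; if
    [2a + b = 2C - 1], only [R] is left over, and two copies of the same leaf
    are oriented differently. *)

From mathcomp Require Import zify.
Require Import Defs.
From mathcomp Require Import all_boot.

Set Implicit Arguments.
Unset Strict Implicit.
Unset Printing Implicit Defensive.

(** * Counting incidences between two finite families *)

Section DoubleCounting.
Variables (X Y : finType) (F : {set X}) (G : {set Y}) (r : X -> Y -> bool).

Lemma sum_degrees :
  \sum_(x in F) #|[set y in G | r x y]| = \sum_(y in G) #|[set x in F | r x y]|.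
Proof.
pose m x y := (x \in F) && ((y \in G) && r x y).
transitivity (\sum_(x : X) \sum_(y : Y) (m x y : nat)).
  rewrite [LHS]big_mkcond; apply: eq_bigr => x _; rewrite /m.
  case: (x \in F); last by rewrite big1.
  by rewrite -sum1dep_card big_mkcond; apply: eq_bigr => y _; case: ifP.
rewrite exchange_big [RHS]big_mkcond; apply: eq_bigr => y _; rewrite /m.
case: (y \in G); last by rewrite big1 // => x _; rewrite andbF.
by rewrite -sum1dep_card [RHS]big_mkcond; apply: eq_bigr => x _; case: ifP.
Qed.

Variables (p q : nat).
Hypothesis deg_F : forall x, x \in F -> p <= #|[set y in G | r x y]|.
Hypothesis deg_G : forall y, y \in G -> #|[set x in F | r x y]| <= q.

Lemma double_count : #|F| * p <= #|G| * q.
Proof.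
rewrite -!sum_nat_const.
apply: (@leq_trans (\sum_(x in F) #|[set y in G | r x y]|)); first exact: leq_sum.
by rewrite sum_degrees leq_sum.
Qed.

(** Equality in the double count leaves no room in the termwise bounds, so every degree bound on [G]
    is attained. *)
Lemma double_count_eq :
  #|G| * q <= #|F| * p -> forall y, y \in G -> #|[set x in F | r x y]| = q.
Proof.
move=> le_GF y yG.
have: \sum_(y in G) #|[set x in F | r x y]| == \sum_(y in G) q.
  rewrite eqn_leq leq_sum //= -sum_degrees sum_nat_const (leq_trans le_GF) //.
  by rewrite -sum_nat_const leq_sum.
rewrite (leqif_sum (C := fun y => #|[set x in F | r x y]| == q)).
  by move=> /forall_inP /(_ y yG) /eqP.
by move=> z zG; split=> //; apply: deg_G.
Qed.

End DoubleCounting.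

(** * Upshadows, Sperner's theorem and nearly extremal antichains *)

Section Antichains.
Variable T : finType.
Implicit Types (A B : {set T}) (F G S : {set {set T}}).

Definition layer (j : nat) : {set {set T}} := [set A : {set T} | #|A| == j].

Definition antichain S := {in S &, forall A B, A \subset B -> A = B}.

Definition upshadow S : {set {set T}} := [set x |: A | A in S, x in ~: A].

Lemma card_layer j : #|layer j| = 'C(#|T|, j).
Proof. exact: card_draws. Qed.

Lemma upshadowP S B :
  reflect (exists2 A, A \in S & A \subset B /\ #|B| = #|A|.+1) (B \in upshadow S).
Proof.
apply: (iffP imset2P) => [[A x AS]|[A AS [sAB cB]]].
  by rewrite inE => xA ->; exists A => //; rewrite subsetUr cardsU1 xA.
have /card_gt0P[x] : 0 < #|B :\: A|.
  by rewrite cardsD (setIidPr sAB) cB subSnn.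
rewrite inE => /andP[xA xB]; exists A x; rewrite ?inE //; apply/esym/eqP.
by rewrite eqEcard subUset sub1set xB sAB cardsU1 xA cB leqnn.
Qed.

Lemma card_upshadow1 A : #|upshadow [set A]| = #|T| - #|A|.
Proof.
have -> : upshadow [set A] = [set x |: A | x in ~: A].
  apply/setP=> B; apply/imset2P/imsetP => [[_ x /set1P -> ? ->]|[x ? ->]].
    by exists x.
  by exists A x; rewrite ?set11.
rewrite card_in_imset.
  by rewrite [LHS]cardsCs setCK.
move=> x y; rewrite !inE => xA yA.
by move/setP/(_ x); rewrite !inE eqxx (negPf xA) !orbF => /esym/eqP.
Qed.

Lemma upshadow_layer S j : S \subset layer j -> upshadow S \subset layer j.+1.
Proof.
move=> /subsetP sS; apply/subsetP => B /upshadowP[A /sS].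
by rewrite !inE => /eqP <- [_ ->].
Qed.

Section UpshadowOfLayer.
Variables (S : {set {set T}}) (j : nat).
Hypothesis S_layer : S \subset layer j.

Lemma up_degree A : A \in S -> #|T| - j <= #|[set B in upshadow S | A \subset B]|.
Proof.
move=> AS; have := subsetP S_layer _ AS; rewrite inE => /eqP <-.
rewrite -card_upshadow1 subset_leq_card //; apply/subsetP => B.
case/upshadowP=> A0 /set1P -> [sAB cB]; rewrite inE sAB andbT.
by apply/upshadowP; exists A.
Qed.

Lemma down_degree B :
  B \in upshadow S -> #|[set A in S | A \subset B]| <= j.+1.
Proof.
move=> /(subsetP (upshadow_layer S_layer)); rewrite inE => /eqP cB.
have -> : j.+1 = 'C(#|B|, j) by rewrite cB binSn.
rewrite -cards_draws subset_leq_card //.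
apply/subsetP=> A; rewrite !inE => /andP[/(subsetP S_layer)].
by rewrite inE => -> ->.
Qed.

(** Local LYM inequality: among the pairs [A \subset B] with [A] in [S] and [B] in the upshadow,
    each [A] occurs at least [#|T| - j] times and each [B] at most [j.+1] times. *)
Lemma upshadow_normalized : #|S| * (#|T| - j) <= #|upshadow S| * j.+1.
Proof. exact: double_count up_degree down_degree. Qed.

(** Here [#|T| - j >= j + 3]. A family with more than [j] members grows by the ratio
    [(j + 3) / (j + 1)], hence by at least two; a smaller one is already beaten by the [j + 3] upper
    neighbours of a single member. *)
Lemma upshadow_below_middle :
  j.*2.+3 <= #|T| -> S != set0 -> #|S| + 2 <= #|upshadow S|.
Proof.
move=> lt_jT /set0Pn[A AS]; have := upshadow_normalized.
have : #|T| - j <= #|upshadow S|.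
  by apply: leq_trans (up_degree AS) (subset_leq_card _); rewrite setIdE subsetIl.
nia.
Qed.

End UpshadowOfLayer.

(* A family as large as its upshadow in the next layer of the same size
   contains every set obtained by exchanging one element. *)
Lemma upshadow_middle S k :
  #|T| = k.*2.+1 -> S \subset layer k -> S != set0 -> S != layer k ->
  #|S| < #|upshadow S|.
Proof.
move=> cT sS S0 Sk; rewrite ltnNge; apply: contra Sk => le_up.
have degB := double_count_eq (up_degree sS) (down_degree sS).
(* If [A] and [B] differ by one exchange, both lie below [A :|: B], an upper neighbour of [A];
   equality in the double count puts all [k.+1] lower neighbours of that set in [S]. *)
have exch A B : A \in S -> B \in layer k -> #|A :\: B| <= 1 -> B \in S.
  rewrite inE => AS /eqP cB cAB.
  have /eqP cA : #|A| == k by have := subsetP sS _ AS; rewrite inE.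
  case: (eqVneq A B) => [<- //|nAB].
  have dAB : #|A :\: B| = 1.
    apply/eqP; rewrite eqn_leq cAB lt0n cards_eq0 setD_eq0.
    by apply: contra nAB => sAB; rewrite eqEcard sAB cA cB leqnn.
  have cU : #|A :|: B| = k.+1.
    have := cardsID B A; have := cardsUI A B; lia.
  have UB : A :|: B \in upshadow S.
    by apply/upshadowP; exists A; rewrite ?subsetUl ?cU ?cA.
  have degU : #|[set C in S | C \subset A :|: B]| = k.+1.
    apply: (degB _ _ UB); rewrite cT (_ : k.*2.+1 - k = k.+1); last by lia.
    by rewrite leq_mul2r le_up orbT.
  have eqs : [set C in S | C \subset A :|: B]
      = [set C : {set T} | C \subset A :|: B & #|C| == k].
    apply/eqP; rewrite eqEcard degU cards_draws cU binSn leqnn andbT.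
    apply/subsetP => C; rewrite !inE => /andP[/(subsetP sS)].
    by rewrite inE => -> ->.
  have : B \in [set C : {set T} | C \subset A :|: B & #|C| == k].
    by rewrite inE subsetUr cB eqxx.
  by rewrite -eqs inE => /andP[].
have [A0 A0S] := set0Pn _ S0.
rewrite eqEsubset sS; apply/subsetP => B BL.
(* Induction on [#|A :\: B|]: exchanging an [x] of [A :\: B] for a [y] of [B :\: A] stays in [S] and
   comes closer to [B]. *)
elim: {A0}_.+1 {-2}A0 (ltnSn #|A0 :\: B|) A0S => // m IH A lt_m AS.
case: (leqP #|A :\: B| 1) => [|gt1]; first exact: exch AS BL.
have cA : #|A| = k by have := subsetP sS _ AS; rewrite inE => /eqP.
have cB : #|B| = k by move: BL; rewrite inE => /eqP.
have /card_gt0P[x] : 0 < #|A :\: B| by lia.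
have /card_gt0P[y] : 0 < #|B :\: A|.
  by have := cardsID B A; have := cardsID A B; rewrite (setIC B A); lia.
rewrite !inE => /andP[yA yB] /andP[xB xA].
have cA' : #|y |: A :\ x| = k.
  rewrite cardsU1 !inE (negPf yA) andbF; have := cardsD1 x A; rewrite xA; lia.
apply: (IH (y |: A :\ x)).
  apply: leq_trans _ (lt_m : #|A :\: B| <= m); apply: proper_card.
  apply/properP; split; last by exists x; rewrite !inE ?xB ?xA ?eqxx ?andbF ?orbF //; apply: contraNneq xB => ->.
  apply/subsetP => z; rewrite !inE => /andP[zB /orP[/eqP zy|/andP[_ ->]]].
    by rewrite zy yB in zB.
  by rewrite zB.
apply: exch AS _ _; first by rewrite inE cA'.
apply: leq_trans (_ : #|[set x]| <= _); last by rewrite cards1.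
apply/subset_leq_card/subsetP => z; rewrite !inE negb_or negb_and negbK.
by case/andP => /andP[_ /orP[//|/negPf ->]].
Qed.


(** The lowest level is replaced by its upshadow until level [k] is reached, each replacement
    gaining at least two sets. No new set above level [k] is created, which lets a second pass on
    complements end in the middle layers. *)
Lemma antichain_lift S k :
  #|T| = k.*2.+1 -> antichain S ->
  exists S', [/\ antichain S', forall A, A \in S' -> k <= #|A|,
    forall A, A \in S' -> #|A| <= k \/ A \in S,
    forall A, A \in S -> k <= #|A| -> A \in S' &
    #|S| <= #|S'| /\ ((exists2 A, A \in S & #|A| < k) -> #|S| + 2 <= #|S'|)].
Proof.
move=> cT.
(* [l] is a lower bound for the sizes and [m] the number of levels still to be raised. *)
suff lift m l S0 : m + l = k -> (forall A, A \in S0 -> l <= #|A|) -> antichain S0 ->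
  exists S', [/\ antichain S', forall A, A \in S' -> k <= #|A|,
    forall A, A \in S' -> #|A| <= k \/ A \in S0,
    forall A, A \in S0 -> k <= #|A| -> A \in S' &
    #|S0| <= #|S'| /\ ((exists2 A, A \in S0 & #|A| < k) -> #|S0| + 2 <= #|S'|)].
  by apply: (lift k 0) => //; rewrite addn0.
elim: m l S0 => [|m IH] l S0.
  rewrite add0n => -> ge_k aS; exists S0; split=> //; first by move=> A; right.
  by split=> // -[A /ge_k]; lia.
move=> eq_ml ge_l aS; pose F := [set A in S0 | #|A| == l].
have sF : F \subset layer l by apply/subsetP=> A; rewrite !inE => /andP[].
have sFS : F \subset S0 by rewrite /F setIdE subsetIl.
case: (eqVneq F set0) => [F0|F0].
  apply: (IH l.+1) => //; first by lia.
  move=> A AS; rewrite ltn_neqAle ge_l // andbT eq_sym.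
  by apply: contra_eqN F0 => cA; apply/set0Pn; exists A; rewrite inE AS.
have upF : #|F| + 2 <= #|upshadow F| by apply: (upshadow_below_middle sF) => //; lia.
have cup B : B \in upshadow F -> #|B| = l.+1.
  by move/(subsetP (upshadow_layer sF)); rewrite inE => /eqP.
pose S1 := (S0 :\: F) :|: upshadow F.
have gt_l A : A \in S0 -> A \notin F -> l < #|A|.
  by rewrite inE => AS; rewrite AS ltn_neqAle ge_l // eq_sym => ->.
have dS : [disjoint S0 :\: F & upshadow F].
  rewrite -setI_eq0; apply/eqP/setP=> B; rewrite in_setI in_setD in_set0.
  apply/negP => /andP[/andP[_ BS] /upshadowP[A AF [sAB]]].
  by rewrite (aS A B (subsetP sFS _ AF)) //; lia.
have cS1 : #|S0| + 2 <= #|S1|.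
  have := cardsUI (S0 :\: F) (upshadow F).
  rewrite (eqP (_ : _ :&: _ == set0)) ?setI_eq0 // cards0 -/S1.
  have := cardsID F S0; rewrite (setIidPr sFS); lia.
have aS1 : antichain S1.
  move=> A B; rewrite !in_setU !in_setD => /orP[/andP[AF AS]|Aup] /orP[/andP[BF BS]|Bup] sAB.
  - exact: aS.
  - apply/eqP; rewrite eqEcard sAB (cup B) //; exact: gt_l.
  - case/upshadowP: Aup sAB BF => A0 A0F [sA0 _] sAB.
    by rewrite -(aS A0 B) ?A0F // ?(subsetP sFS) // (subset_trans sA0).
  - by apply/eqP; rewrite eqEcard sAB (cup A) ?(cup B) /=.
have [||S' [aS' geS' leS' keepS' [cS' _]]] := IH l.+1 S1 _ _ aS1; first by lia.
  move=> A; rewrite in_setU in_setD => /orP[/andP[AF AS]|/cup ->] //.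
  exact: gt_l.
exists S'; split=> //; last by split; lia.
  move=> A /leS'[|]; first by left.
  rewrite in_setU in_setD => /orP[/andP[_ ->]|/cup ->]; first by right.
  by left; lia.
move=> A AS leA; apply: keepS' => //; rewrite in_setU in_setD AS andbT.
by apply/orP; left; rewrite inE AS; apply/eqP; lia.
Qed.

Definition compl S : {set {set T}} := [set ~: A | A in S].

Lemma in_compl S A : (A \in compl S) = (~: A \in S).
Proof.
by apply/imsetP/idP => [[B BS ->]|AS]; [rewrite setCK | exists (~: A); rewrite ?setCK].
Qed.

Lemma card_compl S : #|compl S| = #|S|.
Proof. by rewrite card_imset //; apply: inv_inj setCK. Qed.

Lemma antichain_compl S : antichain S -> antichain (compl S).
Proof.
move=> aS A B; rewrite !in_compl => AS BS sAB.
by apply: setC_inj; apply/esym/aS; rewrite ?setCS.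
Qed.

Section OddGroundSet.
Variable k : nat.
Hypothesis cardT : #|T| = k.*2.+1.

Lemma card_layer_middle : #|layer k| = #|layer k.+1|.
Proof.
rewrite !card_layer -[RHS]bin_sub; last by lia.
by congr 'C(_, _); lia.
Qed.

(** Let [G] and [F] be the parts of sizes [k] and [k.+1]; the upshadow of [G] avoids [F]. Unless [G]
    is empty or the whole layer, this upshadow is larger than [G]. If [S] is then at most one short
    of the bound, the upshadow and [F] exhaust layer [k.+1], so every set of that layer contains a
    member of [S]. *)
Lemma antichain_middle S :
  antichain S -> S \subset layer k :|: layer k.+1 ->
  #|S| <= #|layer k| /\
  (#|layer k| <= #|S| + 1 ->
   [\/ S = layer k, S \subset layer k.+1 |
       #|S| < #|layer k| /\
       forall B, k < #|B| -> exists2 A, A \in S & A \subset B]).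
Proof.
move=> aS sS; pose G := S :&: layer k; pose F := S :&: layer k.+1.
have sG : G \subset layer k by apply: subsetIr.
have dkk : layer k :&: layer k.+1 = set0.
  by apply/setP => A; rewrite !inE; case: eqP => // ->; lia.
have cS : #|S| = #|G| + #|F|.
  have := cardsUI G F; rewrite -setIUr (setIidPl sS).
  by rewrite /G setIACA dkk setI0 cards0 addn0.
have dF : upshadow G \subset layer k.+1 :\: F.
  apply/subsetP => B Bup; have := subsetP (upshadow_layer sG) _ Bup.
  rewrite in_setD => BL; rewrite BL andbT in_setI BL andbT.
  case/upshadowP: Bup BL => A; rewrite !inE => /andP[AS /eqP cA] [sAB cB] _.
  by apply/negP => BS; move: cB; rewrite (aS A B) //; lia.
have cF := cardsID F (layer k.+1).
rewrite (setIidPr (subsetIr _ _)) -card_layer_middle -/F in cF.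
have cup := subset_leq_card dF.
case: (eqVneq G set0) => [G0|G0].
  rewrite cS G0 cards0; split; first by lia.
  move=> _; constructor 2; apply/subsetP => A AS; have := subsetP sS _ AS.
  rewrite in_setU => /orP[AL|//].
  by have := in_set0 A; rewrite -G0 in_setI AS AL.
case: (eqVneq G (layer k)) => [GL|GL].
  have F0 : #|F| = 0.
    have := upshadow_normalized sG; rewrite GL in cup *; rewrite cardT.
    have -> : k.*2.+1 - k = k.+1 by lia.
    rewrite leq_pmul2r //; lia.
  have SG : S = G.
    by apply/eqP; rewrite eq_sym eqEcard subsetIl cS F0 addn0 leqnn.
  by rewrite SG GL; split=> // _; constructor 1.
have lt_up := upshadow_middle cardT sG G0 GL.
split; first by lia.
move=> geS; constructor 3; split; first by lia.
have dFe : upshadow G = layer k.+1 :\: F.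
  by apply/eqP; rewrite eqEcard dF; lia.
move=> B kB.
have : 0 < #|[set A : {set T} | A \subset B & #|A| == k.+1]|.
  by rewrite cards_draws bin_gt0.
case/card_gt0P => A; rewrite inE => /andP[sAB cA].
case: (boolP (A \in F)) => [|AF].
  by rewrite inE => /andP[AS _]; exists A.
have : A \in upshadow G by rewrite dFe in_setD AF inE.
case/upshadowP => C; rewrite inE => /andP[CS _] [sCA _].
by exists C => //; apply: subset_trans sCA sAB.
Qed.

(** [S] is lifted, then the complements of the result are lifted: the first pass removes the sets
    below the middle, the second those above it. The two middle layers are exchanged by
    complementation, so the outcome need not be complemented back. *)
Lemma antichain_to_middle S :
  antichain S ->
  exists S', [/\ antichain S', S' \subset layer k :|: layer k.+1 &
    #|S| <= #|S'| /\ (~~ (S \subset layer k :|: layer k.+1) -> #|S| + 2 <= #|S'|)].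
Proof.
move=> aS; have [S1 [aS1 ge1 _ keep1 [c1 d1]]] := antichain_lift cardT aS.
have [S2 [aS2 ge2 le2 _ [c2 d2]]] := antichain_lift cardT (antichain_compl aS1).
rewrite card_compl in c2 d2.
have cC A : #|~: A| = k.*2.+1 - #|A| by rewrite cardsCs setCK cardT.
exists S2; split=> //.
  apply/subsetP => A AS2; rewrite !inE; have := ge2 _ AS2.
  case: (le2 _ AS2) => [|]; first by lia.
  by rewrite in_compl => /ge1; rewrite cC; have := max_card A; rewrite cardT; lia.
split; first by lia.
case/subsetPn => A AS; rewrite !inE => cA.
have [ltA|geA] := ltnP #|A| k; first by have := d1 (ex_intro2 _ _ A AS ltA); lia.
(* A set of more than [k.+1] elements survives the first pass, and its complement, of fewer than [k]
   elements, makes the second pass gain two. *)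
suff: #|S1| + 2 <= #|S2| by lia.
apply: d2; exists (~: A); first by rewrite in_compl setCK keep1.
by rewrite cC; have := max_card A; rewrite cardT; move: cA geA; lia.
Qed.

(* Levels below the middle are pushed up by the upshadow, gaining at least two
   sets, and levels above it are pushed down; the family then meets only the two
   middle layers. *)
Theorem near_sperner S :
  antichain S ->
  #|S| <= #|layer k| /\
  (#|layer k| <= #|S| + 1 ->
   [\/ S = layer k, S \subset layer k.+1 |
       #|S| < #|layer k| /\
       forall B, k < #|B| -> exists2 A, A \in S & A \subset B]).
Proof.
move=> aS; have [S' [aS' sS' [cS dS]]] := antichain_to_middle aS.
have [leS' _] := antichain_middle aS' sS'.
split=> [|geS]; first by lia.
(* A gain of two would carry [S'] past the bound [#|layer k|], so [S] already lies in the middle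
   layers. *)
have [sS|/dS] := boolP (S \subset layer k :|: layer k.+1); last by lia.
by have [_] := antichain_middle aS sS; apply.
Qed.

Corollary near_sperner_dual S :
  antichain S -> #|layer k| <= #|S| + 1 ->
  [\/ S = layer k.+1, S \subset layer k |
      #|S| < #|layer k| /\
      forall B, #|B| <= k -> exists2 A, A \in S & B \subset A].
Proof.
move=> aS; have [_] := near_sperner (antichain_compl aS); rewrite card_compl => H /H.
have cC A : #|~: A| = k.*2.+1 - #|A| by rewrite cardsCs setCK cardT.
case=> [eS|sS|[ltS supS]].
- constructor 1; apply/setP => A; rewrite -[A in LHS]setCK -in_compl eS !inE cC.
  by apply/eqP/eqP; have := max_card A; rewrite cardT; lia.
- constructor 2; apply/subsetP => A AS.
  have : ~: A \in compl S by rewrite in_compl setCK.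
  move/(subsetP sS); rewrite !inE cC.
  by have := max_card A; rewrite cardT; lia.
constructor 3; split=> // B leB; have [|A] := supS (~: B).
  by rewrite cC; lia.
by rewrite in_compl => AS sAB; exists (~: A); rewrite // -setCS setCK.
Qed.

(** Padded to size [k.-1], the set [B] has [k + 2] one-element extensions, all of size [k]. *)
Lemma many_supersets B :
  #|B| < k -> 3 <= #|[set A in layer k | B \subset A]|.
Proof.
move=> ltB.
have /card_gt0P[B'] : 0 < #|[set A : {set T} | A \subset ~: B & #|A| == k - #|B| - 1]|.
  by rewrite cards_draws bin_gt0 [#|~: B|]cardsCs setCK cardT; lia.
rewrite inE => /andP[sB' /eqP cB'].
have cU : #|B :|: B'| = k.-1.
  have := cardsUI B B'; rewrite (_ : B :&: B' = set0) ?cards0; first by lia.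
  by apply/eqP; rewrite setI_eq0 disjoint_sym disjoints_subset.
have := card_upshadow1 (B :|: B'); rewrite cU cardT => cup.
apply: leq_trans (_ : #|upshadow [set B :|: B']| <= _); first by lia.
apply/subset_leq_card/subsetP => A /upshadowP[A' /set1P -> [sA cA]].
rewrite !inE cA cU (subset_trans (subsetUl _ _) sA) andbT; lia.
Qed.

End OddGroundSet.
End Antichains.

(** At most one element of [L] is outside [S], so at least two elements of [F] lie in [S]. *)
Lemma exists_other (X : finType) (F S L : {set X}) (z : X) :
  F \subset L -> S \subset L -> #|L| <= #|S| + 1 -> 3 <= #|F| ->
  exists2 a, a \in F & a \in S /\ a != z.
Proof.
move=> sF sS leL geF.
have cD := cardsID S L; rewrite (setIidPr sS) in cD.
have := subset_leq_card (setSD S sF); have := cardsID S F.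
have := cardsD1 z (F :&: S); have := leq_b1 (z \in F :&: S) => c0 c1 c2 c3.
have /card_gt0P[a] : 0 < #|(F :&: S) :\ z| by lia.
by rewrite !inE => /and3P[nz aF aS]; exists a.
Qed.

Lemma one_missing (X : finType) (S L : {set X}) :
  S \subset L -> #|S| < #|L| -> #|L| <= #|S| + 1 ->
  exists2 a, L :\: S = [set a] & #|S| + 1 = #|L|.
Proof.
move=> sS ltS leL; have := cardsID S L; rewrite (setIidPr sS) => cD.
have /cards1P[a ea] : #|L :\: S| == 1 by apply/eqP; lia.
by exists a => //; lia.
Qed.

(** * Subsets of prescribed size and exchanges of one element *)

Section SetsOfGivenSize.
Variable T : finType.
Implicit Types A B R U Z : {set T}.

Lemma subset_of_card m B : m <= #|B| -> exists2 A : {set T}, A \subset B & #|A| = m.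
Proof.
move=> le_m; have : 0 < #|[set A : {set T} | A \subset B & #|A| == m]|.
  by rewrite cards_draws bin_gt0.
by case/card_gt0P => A; rewrite inE => /andP[sAB /eqP cA]; exists A.
Qed.

Lemma superset_of_card m B :
  #|B| <= m -> m <= #|T| -> exists2 A : {set T}, B \subset A & #|A| = m.
Proof.
move=> leB lem; have [|A sA cA] := @subset_of_card (#|T| - m) (~: B).
  by rewrite cardsCs setCK; lia.
by exists (~: A); [rewrite -setCS setCK | rewrite cardsCs setCK cA; lia].
Qed.

(** By Pascal's rule, a set of more than [m > 0] elements has at least two subsets of size [m]. *)
Lemma unique_subset m U Z :
  0 < m <= #|U| -> (forall A, #|A| = m -> A \subset U -> A = Z) -> U = Z.
Proof.
move=> /andP[m_gt0 leU] uniqZ.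
case: (ltngtP m #|U|) leU => // [ltU _|eU _]; last exact: uniqZ.
have: #|[set A : {set T} | A \subset U & #|A| == m]| <= #|[set Z]|.
  apply/subset_leq_card/subsetP => A; rewrite !inE => /andP[sA /eqP cA].
  by rewrite (uniqZ A).
rewrite cards_draws cards1; case: #|U| ltU => // u ltu; case: m m_gt0 ltu {uniqZ} => // m _ ltu.
have := bin_gt0 u m.+1; have := bin_gt0 u m; rewrite binS; lia.
Qed.

(** The neighbours of [R] in the Johnson graph. *)
Definition exchanges R : {set {set T}} :=
  [set y |: R :\ x | x in R, y in ~: R].

Lemma card_exchanges R : #|exchanges R| = #|R| * (#|T| - #|R|).
Proof.
have -> : exchanges R = [set z.2 |: R :\ z.1 | z in setX R (~: R)].
  apply/setP=> B; apply/imset2P/imsetP => [[x y xR yR ->]|[[x y]]].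
    by exists (x, y); rewrite // inE /= xR.
  by rewrite inE /= => /andP[xR yR] ->; exists x y.
rewrite card_in_imset; first by rewrite cardsX [#|~: R|]cardsCs setCK.
move=> [x y] [x' y']; rewrite !inE /= => /andP[xR yR] /andP[x'R y'R] eqB.
have xy' : x != y' by apply: contraNneq y'R => <-.
have yR' : y != x' by apply: contraNneq yR => ->.
have exx : x = x'.
  have /setP/(_ x) := eqB; rewrite !inE eqxx xR (negPf xy') /= andbT orbF.
  have -> : (x == y) = false by apply: contraNF yR => /eqP <-.
  by move/esym/negbFE/eqP.
rewrite -exx in eqB *; congr (_, _); have /setP/(_ y) := eqB.
by rewrite !inE eqxx (negPf yR) !andbF !orbF => /esym/eqP.
Qed.

Lemma exchangesP R B :
  reflect [/\ #|B| = #|R|, B != R & #|R :|: B| = #|R|.+1] (B \in exchanges R).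
Proof.
apply: (iffP imset2P) => [[x y xR]|[cB nB cU]].
  rewrite inE => yR ->.
  have cR := cardsD1 x R; rewrite xR in cR.
  have -> : R :|: (y |: R :\ x) = y |: R.
    by apply/setP=> z; rewrite !inE; case: (z == y); case: (z \in R); rewrite ?orbT ?andbF.
  split; first by rewrite cardsU1 !inE (negPf yR) andbF; lia.
    by apply: contraNneq yR => <-; rewrite !inE eqxx.
  by rewrite cardsU1 yR.
have c1 : #|R :\: B| = 1 by have := cardsUI R B; have := cardsID B R; lia.
have c2 : #|B :\: R| = 1.
  by have := cardsUI R B; have := cardsID R B; rewrite (setIC B R); lia.
have /cards1P[x ex] := introT eqP c1; have /cards1P[y ey] := introT eqP c2.
have xP z : (z \in R) && (z \notin B) = (z == x).
  by have /setP/(_ z) := ex; rewrite !inE andbC.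
have yP z : (z \in B) && (z \notin R) = (z == y).
  by have /setP/(_ z) := ey; rewrite !inE andbC.
exists x y; first by have := xP x; rewrite eqxx => /andP[].
  by have := yP y; rewrite eqxx inE => /andP[].
apply/setP=> z; rewrite !inE; have := xP z; have := yP z.
by case: (z \in B); case: (z \in R) => //= <- <-.
Qed.

(** When the sets [Q i] fill the [k]-layer up to one set, this puts an out-set of [j] with fewer
    than [k] elements below some [Q i] with [i != j], which a leaf system forbids. *)
Lemma missing_superset k (S : {set {set T}}) B Z :
  #|T| = k.*2.+1 -> S \subset layer T k -> #|layer T k| <= #|S| + 1 -> #|B| < k ->
  exists A : {set T}, [/\ A \in S, B \subset A & A != Z].
Proof.
move=> cT sS cS ltB; have := many_supersets cT ltB => cF.
have [|A AF [AS nA]] := exists_other Z _ sS cS cF.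
  by apply/subsetP => A; rewrite inE => /andP[].
by move: AF; rewrite inE => /andP[_ sB]; exists A.
Qed.

Lemma exists_middle k : #|T| = k.*2.+1 -> exists R : {set T}, #|R| = k.
Proof.
move=> cT; have [|R _ cR] := @subset_of_card k setT; last by exists R.
by rewrite cardsT cT; lia.
Qed.

Lemma exchanges_bound k : #|T| = k.*2.+1 -> k * k.+1 + 1 <= 'C(k.*2.+1, k).
Proof.
move=> cT; have [R cR] := exists_middle cT.
have <- : #|exchanges R| = k * k.+1.
  by rewrite card_exchanges cR cT; congr (_ * _); lia.
rewrite -cT -card_layer (cardsD1 R (layer T k)) inE cR eqxx addnC leq_add2l.
apply/subset_leq_card/subsetP => A /exchangesP[cA nA _].
by rewrite !inE nA cA cR eqxx.
Qed.

End SetsOfGivenSize.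

(** * Extremal analysis of the antichains of an orientation *)

Section Necessity.
Variables (T J : finType) (k : nat).
Implicit Types A B R U Z : {set T}.
Hypothesis cardT : #|T| = k.*2.+1.
Hypothesis k_gt0 : 0 < k.

(* [N] is the set of neighbours of the centre and [NL] that of the non-leaf
   ones. [O i] collects the out-sets (in the centre class) of the copies of
   [i]; for a leaf copy [x] attached to [i], [P i] is the union of the
   out-sets of the out-neighbours of [x], and [Q i] is the intersection of
   the out-sets of its in-neighbours. [I1] (resp. [I2]) contains the [i] for
   which [x] has exactly one out-neighbour (resp. in-neighbour). *)
Record leaf_system (N NL I1 I2 : {set J}) (O : J -> {set {set T}})
    (P Q : J -> {set T}) : Prop := LeafSystem {
  NL_N : NL \subset N;
  I1_NL : I1 \subset NL;
  I2_NL : I2 \subset NL;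
  O_neq0 : forall j, j \in N -> O j != set0;
  P_cross : forall i j U, j \in NL -> i \in N -> i != j -> U \in O i -> ~~ (P j \subset U);
  Q_cross : forall i j U, j \in NL -> i \in N -> i != j -> U \in O i -> ~~ (U \subset Q j);
  P_in : forall j, j \in I1 -> P j \in O j;
  Q_in : forall j, j \in I2 -> Q j \in O j;
  P_sub : forall j (Z : {set T}), j \in NL -> (forall U, U \in O j -> U \subset Z) -> P j \subset Z;
  Q_sup : forall j (Z : {set T}), j \in NL -> (forall U, U \in O j -> Z \subset U) -> Z \subset Q j
}.

(** Reversing all arcs replaces out-sets by their complements and exchanges out-neighbours with
    in-neighbours. *)
Lemma leaf_system_dual N NL I1 I2 O P Q :
  leaf_system N NL I1 I2 O P Q ->
  leaf_system N NL I2 I1 (fun j => compl (O j)) (fun j => ~: Q j) (fun j => ~: P j).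
Proof.
case=> sN s1 s2 O0 crP crQ inP inQ subP supQ; split=> //.
- by move=> j /O0/set0Pn[U UO]; apply/set0Pn; exists (~: U); rewrite in_compl setCK.
- move=> i j U jN iN ij; rewrite in_compl => UO; rewrite -setCS setCK; exact: crQ UO.
- move=> i j U jN iN ij; rewrite in_compl => UO; rewrite -setCS setCK; exact: crP UO.
- by move=> j /inQ; rewrite in_compl setCK.
- by move=> j /inP; rewrite in_compl setCK.
- move=> j Z jN subZ; rewrite -setCS setCK; apply: supQ => // U UO.
  by rewrite -setCS setCK; apply: subZ; rewrite in_compl setCK.
- move=> j Z jN subZ; rewrite -setCS setCK; apply: subP => // U UO.
  by rewrite -setCS setCK; apply: subZ; rewrite in_compl setCK.
Qed.

Section System.
Variables (N NL I1 I2 : {set J}) (O : J -> {set {set T}}) (P Q : J -> {set T}).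
Hypothesis sys : leaf_system N NL I1 I2 O P Q.

Let I1N i : i \in I1 -> i \in N.
Proof. by move/(subsetP (I1_NL sys))/(subsetP (NL_N sys)). Qed.

Let I2N i : i \in I2 -> i \in N.
Proof. by move/(subsetP (I2_NL sys))/(subsetP (NL_N sys)). Qed.

(** For [j] in [I1] the union [P j] is itself an out-set of [j], so [P_cross] applies to it. *)
Lemma P_mono : {in I1 &, forall i j, P i \subset P j -> i = j}.
Proof.
move=> i j iI jI; apply: contraTeq; rewrite eq_sym => nij.
exact: (P_cross sys (subsetP (I1_NL sys) _ iI) (I1N jI) nij (P_in sys jI)).
Qed.

Lemma Q_mono : {in I2 &, forall i j, Q i \subset Q j -> i = j}.
Proof.
move=> i j iI jI; apply: contraTeq => nij.
exact: (Q_cross sys (subsetP (I2_NL sys) _ jI) (I2N iI) nij (Q_in sys iI)).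
Qed.

Lemma card_P : #|P @: I1| = #|I1|.
Proof. by rewrite card_in_imset // => i j iI jI eP; apply: P_mono; rewrite // eP. Qed.

Lemma card_Q : #|Q @: I2| = #|I2|.
Proof. by rewrite card_in_imset // => i j iI jI eP; apply: Q_mono; rewrite // eP. Qed.

Lemma antichain_P : antichain (P @: I1).
Proof.
by move=> _ _ /imsetP[i iI ->] /imsetP[j jI ->] sP; rewrite (P_mono iI jI sP).
Qed.

Lemma antichain_Q : antichain (Q @: I2).
Proof.
by move=> _ _ /imsetP[i iI ->] /imsetP[j jI ->] sP; rewrite (Q_mono iI jI sP).
Qed.

(** Every subset of [U] of size [l] is some [P i], and [P_cross] forces [i = j]; so [U] has only one
    such subset and equals it. *)
Lemma P_layer_large l j U :
  P @: I1 = layer T l -> 0 < l <= #|U| -> j \in N -> U \in O j -> j \in I1 /\ U = P j.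
Proof.
move=> eP lel jN UO.
have PU A : #|A| = l -> A \subset U -> j \in I1 /\ A = P j.
  move=> cA sA; have : A \in P @: I1 by rewrite eP inE cA.
  case/imsetP => i iI eA; case: (eqVneq j i) => [->//|nij].
  have := P_cross sys (subsetP (I1_NL sys) _ iI) jN nij UO.
  by rewrite -eA sA.
split; last by apply: (unique_subset lel) => A cA /(PU A cA)[].
have [A sA cA] := @subset_of_card T l U (proj2 (andP lel)).
by have [] := PU A cA sA.
Qed.

Lemma Q_superset j U i : i \in I2 -> j \in N -> U \in O j -> U \subset Q i -> i = j.
Proof.
move=> iI jN UO; apply: contraTeq; rewrite eq_sym => nij.
exact: (Q_cross sys (subsetP (I2_NL sys) _ iI) jN nij UO).
Qed.

(** Out-sets of size at least [k] are the sets [P j] themselves, so the [Q j] have at most [k]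
    elements and fill the [k]-layer up to one set. A smaller out-set would lie below a foreign
    [Q i]; hence every neighbour has a large out-set and belongs to [I1]. *)
Lemma P_layer_low : P @: I1 = layer T k -> #|layer T k| <= #|I2| + 1 -> N \subset I1.
Proof.
move=> eP; rewrite -card_Q => geQ.
have large j U : j \in N -> U \in O j -> k <= #|U| -> j \in I1 /\ U = P j.
  by move=> jN UO leU; apply: (P_layer_large eP) => //; rewrite k_gt0.
have cP j : j \in I1 -> #|P j| = k.
  by move=> jI; have := imset_f P jI; rewrite eP inE => /eqP.
have cQ j : j \in I2 -> #|Q j| <= k.
  move=> jI; rewrite leqNgt; apply/negP => gtk.
  have [jI1 eQ] := large j (Q j) (I2N jI) (Q_in sys jI) (ltnW gtk).
  by move: gtk; rewrite eQ cP // ltnn.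
have sQ : Q @: I2 \subset layer T k.
  (* A family filling layer [k.+1] contradicts [cQ]. A dominating family of sets with at most [k]
     elements would contain the whole [k]-layer. *)
  case: (near_sperner_dual cardT antichain_Q geQ) => [eQ|//|[ltQ supQ]].
    have [A _ cA] := @subset_of_card T k.+1 setT ltac:(rewrite cardsT cardT; lia).
    have : A \in Q @: I2 by rewrite eQ inE cA.
    by case/imsetP => i /cQ; move=> cQi eA; rewrite -eA cA ltnn in cQi.
  suff sk : layer T k \subset Q @: I2.
    by have := leq_ltn_trans (subset_leq_card sk) ltQ; rewrite ltnn.
  apply/subsetP => B; rewrite inE => /eqP cB; have [|A AQ sBA] := supQ B; first by lia.
  suff <- : A = B by [].
  case/imsetP: AQ sBA => i /cQ cQi -> sB.
  by apply/esym/eqP; rewrite eqEcard sB cB.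
apply/subsetP => j jN; have /set0Pn[U UO] := O_neq0 sys jN.
case: (leqP k #|U|) => [/(large j U jN UO)[]//|ltU].
have [A [/imsetP[i iI ->] sU nA]] := missing_superset (Q j) cardT sQ geQ ltU.
by rewrite (Q_superset iI jN UO sU) eqxx in nA.
Qed.

(** A neighbour [j] outside [I1] has only out-sets of at most [k] elements; if it is not a leaf,
    [P j] fits in no set of size [k.+1], as each of these is some [P i]. This is impossible if the
    [Q i] dominate all sets of size at most [k]; otherwise they are the [k]-layer without one set
    [R]. *)
Lemma P_layer_high :
  P @: I1 = layer T k.+1 -> #|layer T k| <= #|I2| + 1 ->
  N \subset I1 \/
  [/\ NL \subset I1 :|: I2, #|I2| + 1 = #|layer T k| & k * k.+1 <= #|I1 :&: I2|].
Proof.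
move=> eP; rewrite -card_Q => geQ.
have large j U : j \in N -> U \in O j -> k < #|U| -> j \in I1 /\ U = P j.
  by move=> jN UO leU; apply: (P_layer_large eP).
have no_small j A : j \in NL -> j \notin I1 -> P j \subset A -> k.+1 < #|A|.
  move=> jNL jI sP; rewrite ltnNge; apply/negP => leA.
  have [B sB cB] := @superset_of_card T k.+1 A leA ltac:(rewrite cardT; lia).
  have : B \in P @: I1 by rewrite eP inE cB.
  case/imsetP => i iI eB; have nij : i != j by apply: contraNneq jI => <-.
  have := P_cross sys jNL (I1N iI) nij (P_in sys iI).
  by rewrite -eB (subset_trans sP sB).
(* Each out-set of [j] lies below some [Q i], necessarily [Q j]. So [P j] is contained in [Q j],
   which then has more than [k.+1] elements and puts [j] in [I1]. *)
have satur : (forall B, #|B| <= k -> exists2 A, A \in Q @: I2 & B \subset A) ->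
    N \subset I1.
  move=> supQ; apply/subsetP => j jN; apply/negPn/negP => jI.
  have sub U : U \in O j -> j \in I2 /\ U \subset Q j.
    move=> UO; have [|A /imsetP[i iI ->] sU] := supQ U.
      by rewrite leqNgt; apply: contra jI => /(large j U jN UO)[].
    by rewrite -(Q_superset iI jN UO sU).
  have [jI2 jNL] : j \in I2 /\ j \in NL.
    have /set0Pn[U /sub[jI2 _]] := O_neq0 sys jN.
    by split=> //; apply: (subsetP (I2_NL sys)).
  have := no_small j (Q j) jNL jI (P_sub sys jNL (fun U UO => proj2 (sub U UO))).
  by move/ltnW/(large j _ jN (Q_in sys jI2)) => [jI' _]; rewrite jI' in jI.
case: (near_sperner_dual cardT antichain_Q geQ) => [eQ|sQ|[ltQ supQ]].
- left; apply: satur => B leB.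
  have [||A sA cA] := @superset_of_card T k.+1 B; [lia|rewrite cardT; lia|].
  by exists A => //; rewrite eQ inE cA.
- case: (leqP #|layer T k| #|Q @: I2|) => [leQ|ltQ].
    left; apply: satur => B leB.
    have [||A sA cA] := @superset_of_card T k B; [lia|rewrite cardT; lia|].
    exists A => //; suff -> : Q @: I2 = layer T k by rewrite inE cA.
    by apply/eqP; rewrite eqEcard sQ.
  right; have [R eR cQ] := one_missing sQ ltQ geQ.
  have RP A : #|A| = k -> A = R \/ A \in Q @: I2.
    move=> cA; have /setP/(_ A) := eR; rewrite !inE cA eqxx andbT.
    by case: (boolP (A \in _)) => _; [right | move/esym/eqP; left].
  have cR : #|R| = k.
    by have /setP/(_ R) := eR; rewrite !inE eqxx => /andP[_ /eqP].
  (* Smaller sets lie below a foreign [Q i] and larger ones put [j] in [I1], so only size [k]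
     remains. *)
  have OP j U : j \in N -> j \notin I1 -> U \in O j ->
      U = R \/ (j \in I2 /\ U = Q j).
    move=> jN jI UO; case: (ltngtP #|U| k) => [ltU|gtU|eU].
    - have [A [/imsetP[i iI ->] sU nA]] := missing_superset (Q j) cardT sQ geQ ltU.
      by rewrite (Q_superset iI jN UO sU) eqxx in nA.
    - by have [jI' _] := large j U jN UO gtU; rewrite jI' in jI.
    - case: (RP U eU) => [|/imsetP[i iI eUi]]; [by left | right].
      have := @Q_superset j U i iI jN UO; rewrite eUi subxx => /(_ isT) <-.
      by [].
  split; last 2 first.
  + exact: cQ.
  (* Were [Q j] an exchange of [R] with [j] outside [I1], then [P j] would lie in [R :|: Q j], which
     has only [k.+1] elements. *)
  + have <- : #|exchanges R| = k * k.+1 by rewrite card_exchanges cR cardT; congr (_ * _); lia.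
    apply: leq_trans (leq_imset_card Q _); apply/subset_leq_card/subsetP => B.
    case/exchangesP; rewrite cR => cB nB cU.
    case: (RP B cB) => [eB|]; first by rewrite eB eqxx in nB.
    case/imsetP=> j jI eB; apply/imsetP; exists j => //; rewrite inE jI andbT.
    apply/negPn/negP => jI1; have jNL := subsetP (I2_NL sys) _ jI.
    have := no_small j (R :|: B) jNL jI1; rewrite cU ltnn => H; apply: notF.
    apply: H; apply: (P_sub sys jNL) => U UO.
    case: (OP j U (I2N jI) jI1 UO) => [->|[_ ->]]; first exact: subsetUl.
    by rewrite eB subsetUr.
  (* A vertex in neither family has [R] as its only out-set, so [P j] would lie in [R]. *)
  + apply/subsetP => j jNL; rewrite inE; apply/negPn; rewrite negb_or.
    apply/negP => /andP[jI1 jI2].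
    have := no_small j R jNL jI1; rewrite cR ltnNge leqnSn => H; apply: notF.
    apply: H; apply: (P_sub sys jNL) => U UO.
    case: (OP j U (subsetP (NL_N sys) _ jNL) jI1 UO) => [-> //|[jI _]].
    by rewrite jI in jI2.
- by left; apply: satur.
Qed.

Lemma full_I1 :
  #|layer T k| <= #|I1| -> #|layer T k| <= #|I2| + 1 ->
  N \subset I1 \/
  [/\ NL \subset I1 :|: I2, #|I2| + 1 = #|layer T k| & k * k.+1 <= #|I1 :&: I2|].
Proof.
move=> ge1 ge2; have [_] := near_sperner cardT antichain_P.
rewrite card_P => /(_ ltac:(lia)) [eP|sP|[ltP _]]; last by lia.
  by left; apply: P_layer_low.
apply: P_layer_high => //; apply/eqP.
by rewrite eqEcard sP card_P -card_layer_middle.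
Qed.

End System.

(** Neither family exceeds the layer, so a total at most one short of the maximum makes one of them
    full; duality reduces a full [I2] to a full [I1]. *)
Theorem leaf_system_bound N NL I1 I2 O P Q :
  leaf_system N NL I1 I2 O P Q ->
  [/\ #|I1| <= #|layer T k|, #|I2| <= #|layer T k| &
  2 * #|layer T k| <= #|I1| + #|I2| + 1 ->
  N \subset I1 \/ N \subset I2 \/
  [/\ NL \subset I1 :|: I2, #|I1| + #|I2| + 1 = 2 * #|layer T k|
     & k * k.+1 <= #|I1 :&: I2|]].
Proof.
move=> sys; have sysd := leaf_system_dual sys.
have [le1 _] := near_sperner cardT (antichain_P sys).
have [le2 _] := near_sperner cardT (antichain_P sysd).
rewrite (card_P sys) in le1; rewrite (card_P sysd) in le2.
split=> // ge12; case: (leqP #|layer T k| #|I1|) => [ge1|lt1].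
  have [||[s12 c12 g12]] := full_I1 sys ge1; [lia|by left|].
  by right; right; split=> //; lia.
have [|||[s12 c12 g12]] := full_I1 sysd; [lia|lia|by right; left|].
by right; right; rewrite setUC setIC; split=> //; lia.
Qed.

End Necessity.

(** * Distances and trees of diameter 4 *)

Section Distance.
Variables (V : finType) (r : rel V).

Lemma walk_of_lengthP k x y :
  reflect (exists p, [/\ path r x p, last x p = y & size p = k])
          (walk_of_length r k x y).
Proof.
apply: (iffP existsP) => [[p /andP[rp /eqP lp]]|[p [rp lp sp]]].
  by exists p; split=> //; apply: size_tuple.
by exists (tcast sp (in_tuple p)); rewrite val_tcast rp lp eqxx.
Qed.

(** Unreachable pairs get the value [#|V|], which the bound on [m] excludes. *)
Lemma dist_leP m x y : m < #|V| ->
  reflect (exists p, [/\ path r x p, last x p = y & size p <= m])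
          (dist r x y <= m).
Proof.
move=> ltm; pose P k := walk_of_length r k x y.
apply: (iffP idP) => [le_d|[p [rp lp sp]]].
  have hasP : has P (iota 0 #|V|).
    by rewrite has_find size_iota; apply: leq_ltn_trans le_d ltm.
  have := nth_find 0 hasP; rewrite nth_iota ?add0n; last first.
    by rewrite -[X in _ < X](size_iota 0) -has_find.
  by rewrite /P => /walk_of_lengthP[p [rp lp sp]]; exists p; rewrite sp.
rewrite leqNgt; apply/negP => lt_d.
have := before_find 0 (leq_ltn_trans sp lt_d).
rewrite nth_iota ?add0n; last exact: leq_ltn_trans sp ltm.
by rewrite /P => /walk_of_lengthP; apply; exists p.
Qed.

Lemma connect_dist x y : connect r x y -> dist r x y < #|V|.
Proof.
case/connectP => p0 rp0 ->; case/shortenP: rp0 => p rp up _.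
have szp : (size p).+1 <= #|V|.
  by rewrite -[_.+1]/(size (x :: p)) -(card_uniqP up) max_card.
by apply: (leq_ltn_trans _ szp); apply/dist_leP => //; exists p.
Qed.

Lemma dist_le_diam x y : dist r x y <= diam r.
Proof.
apply: leq_trans (leq_bigmax (F := fun y => dist r x y) y) _.
exact: (leq_bigmax (F := fun x => \max_(y : V) dist r x y) x).
Qed.

Lemma diam_attained : 0 < #|V| -> exists x y, dist r x y = diam r.
Proof.
move=> V_gt0; have [x ex] := eq_bigmax (fun x => \max_(y : V) dist r x y) V_gt0.
have [y ey] := eq_bigmax (fun y => dist r x y) V_gt0.
by exists x, y; rewrite /diam ex ey.
Qed.

End Distance.

Section BigMin.
Variables (I : finType) (P : pred I) (F : I -> nat) (x : nat).

Lemma bigminn_attained m :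
  \big[minn/x]_(i | P i) F i = m -> m < x -> exists2 i, P i & F i = m.
Proof.
move=> <-; apply: (big_ind (fun m => m < x -> exists2 i, P i & F i = m)) => //.
- by rewrite ltnn.
- by move=> a b Ka Kb; rewrite /minn; case: ifP.
- by move=> i Pi _; exists i.
Qed.

Lemma bigminn_leq i : P i -> \big[minn/x]_(i | P i) F i <= F i.
Proof.
move=> Pi; have: i \in index_enum I by rewrite mem_index_enum.
elim: (index_enum I) => // j l IH; rewrite inE big_cons.
case/predU1P => [<-|/IH le_l]; first by rewrite Pi geq_minl.
by case: ifP => // _; apply: leq_trans (geq_minr _ _) le_l.
Qed.

End BigMin.

Section Tree.
Variables (V : finType) (e : rel V) (c : V).
Hypotheses (tree_e : tree e) (diam_e : diam e = 4) (ecc_c : ecc e c = 2).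

Lemma e_sym : symmetric e. Proof. by have [[]] := tree_e. Qed.
Lemma e_irr : irreflexive e. Proof. by have [[]] := tree_e. Qed.
Lemma e_neq u v : e u v -> u != v.
Proof. by apply: contraTneq => ->; rewrite e_irr. Qed.
Lemma e_acyclic p : cycle e p -> uniq p -> size p <= 2.
Proof. by have [_ _ +] := tree_e => + cp up; apply; apply/andP. Qed.

Lemma e_connect u v : connect e u v.
Proof. by have [_ /forallP/(_ u)/forallP/(_ v)] := tree_e. Qed.

Lemma centre_cover v : [\/ v = c, e c v | exists2 p, e c p & e p v].
Proof.
have le2 : dist e c v <= 2.
  rewrite -ecc_c; exact: (leq_bigmax (F := fun y => dist e c y) v).
have /dist_leP/(_ (leqnn _)) [p [rp lp sp]] := connect_dist (e_connect c v).
have {}sp : size p <= 2 by apply: leq_trans sp le2.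
case: p rp lp sp => [|a [|b [|]]] //=; first by move=> _ ->; constructor 1.
  by rewrite andbT => ? <-; constructor 2.
by case/and3P=> ea eb _ <- _; constructor 3; exists a.
Qed.

Lemma level1_indep u v : e c u -> e c v -> ~~ e u v.
Proof.
move=> eu ev; apply/negP => euv.
have := @e_acyclic [:: c; u; v]; rewrite /= eu euv e_sym ev /=.
by rewrite !inE negb_or (e_neq eu) (e_neq ev) (e_neq euv) => /(_ isT isT).
Qed.

Definition level2 v := (v != c) && ~~ e c v.

Lemma level2_parent v : level2 v -> exists2 p, e c p & e p v.
Proof.
by case/andP => nv nev; case: (centre_cover v) => // h; rewrite ?h ?eqxx // in nv nev.
Qed.

(** An edge between two vertices of level two would close a triangle with a common parent, or a
    5-cycle through the centre. *)
Lemma level2_nbr v u : level2 v -> e u v -> e c u.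
Proof.
move=> l2v euv; have [nvc nev] := andP l2v.
have nuc : u != c by apply: contraNneq nev => <-.
have [q ecq eqv] := level2_parent l2v.
case: (centre_cover u) => [uc|//|[p ecp epu]]; first by rewrite uc eqxx in nuc.
case: (boolP (e c u)) => // neu.
have puq : p != u by apply: contraNneq neu => <-.
have qu : q != u by apply: contraNneq neu => <-.
have pv : p != v by apply: contraNneq nev => <-.
have qv : q != v by apply: contraNneq nev => <-.
have uv := e_neq euv; have cp := e_neq ecp; have cq := e_neq ecq.
exfalso; case: (eqVneq p q) => [pq|pq].
  have := @e_acyclic [:: p; u; v]; rewrite /= epu euv pq (e_sym v) eqv /=.
  by rewrite !inE negb_or -pq puq pv uv => /(_ isT isT).
have := @e_acyclic [:: c; p; u; v; q].
rewrite /= ecp epu euv (e_sym v) eqv (e_sym q) ecq /= !inE !negb_or.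
rewrite cp (eq_sym c u) nuc (eq_sym c v) nvc cq puq pv pq uv (eq_sym u) qu (eq_sym v) qv.
by move=> /(_ isT isT).
Qed.

Lemma level2_unique v u w : level2 v -> e u v -> e w v -> u = w.
Proof.
move=> l2v eu ew; have [nvc nev] := andP l2v.
have ecu := level2_nbr l2v eu; have ecw := level2_nbr l2v ew.
apply/eqP/negPn/negP => nuw.
have := @e_acyclic [:: c; u; v; w]; rewrite /= ecu eu (e_sym v) ew (e_sym w) ecw /=.
rewrite !inE !negb_or (e_neq ecu) (e_neq ecw) (eq_sym c) nvc (e_neq eu) nuw.
by rewrite (eq_sym v) (e_neq ew) => /(_ isT isT).
Qed.

(** The bipartition of the tree: the neighbours of [c] are the vertices at odd distance from it. *)
Lemma e_level u v : e u v -> e c v = ~~ e c u.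
Proof.
move=> euv; case: (boolP (e c u)) => [eu|neu].
  by apply/negbTE/negP => ev; move: euv; apply/negP; apply: level1_indep.
case: (eqVneq u c) => [<- //|nuc].
have l2 : level2 u by rewrite /level2 nuc.
by apply: (level2_nbr l2); rewrite e_sym.
Qed.

Lemma level2_not_level1 v : level2 v -> e c v = false.
Proof. by case/andP => _ /negbTE. Qed.

Lemma nonleaf_child v :
  e c v -> (v \notin leaf_nbrs e c) = [exists w, e v w && (w != c)].
Proof.
move=> ecv; rewrite inE ecv /= /deg.
have cN : c \in [set w | e v w] by rewrite inE e_sym.
apply/idP/existsP => [|[w /andP[evw nw]]].
  move=> ne1; have : 1 < #|[set w | e v w]|.
    by rewrite ltn_neqAle eq_sym ne1 /=; apply/card_gt0P; exists c.
  rewrite (cardsD1 c) cN ltnS => /card_gt0P[w]; rewrite !inE => /andP[nw evw].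
  by exists w; rewrite evw.
by rewrite (cardsD1 c) cN eqSS -lt0n; apply/card_gt0P; exists w; rewrite !inE nw.
Qed.

Lemma child_level2 v w : e c v -> e v w -> w != c -> level2 w.
Proof. by move=> ecv evw nw; rewrite /level2 nw (e_level evw) ecv. Qed.

Lemma far_apart : exists x y, dist e x y = 4.
Proof. by rewrite -diam_e; apply: diam_attained; apply/card_gt0P; exists c. Qed.

Lemma card_V : 4 < #|V|.
Proof. by have [x [y <-]] := far_apart; apply/connect_dist/e_connect. Qed.

End Tree.

(** * Orientations of the vertex-multiplication *)

(* [path.arc] shadows the arc relation of a digraph. *)
Local Notation arc := Defs.arc.

Section Multiplication.
Variables (V : finType) (e : rel V) (s : V -> nat) (c : V).
Hypotheses (tree_e : tree e) (diam_e : diam e = 4) (ecc_c : ecc e c = 2).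
Hypothesis s_ge2 : forall v, 2 <= s v.

Local Notation vtx := (vmul_vertex s).
Local Notation copy v i := (Tagged (fun v => 'I_(s v)) (i : 'I_(s v)) : vtx).

Local Notation adj := (@vmul V e s).

Lemma s_gt0 v : 0 < s v. Proof. exact: ltnW. Qed.

Lemma vmulE (x y : vtx) : adj x y = e (tag x) (tag y).
Proof.
by rewrite /vmul /=; case: (boolP (e _ _)) => [/(e_neq tree_e) ->|_]; rewrite ?andbF.
Qed.

Definition copy0 v : vtx := copy v (Ordinal (s_gt0 v)).

Lemma card_vtx : 4 < #|vtx|.
Proof.
apply: leq_trans (card_V c tree_e diam_e) _.
by apply: (leq_card copy0) => u v /(congr1 tag).
Qed.

Section Orientation.
Variable D : {set vtx * vtx}.
Hypothesis orient_D : orientation adj D.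

Lemma orient_arc x y : adj x y -> arc D x y = ~~ arc D y x.
Proof.
have /forallP/(_ x)/forallP/(_ y) := orient_D; case: ifP => // _ + _.
by case: (arc D x y); case: (arc D y x).
Qed.

Lemma arc_e x y : arc D x y -> e (tag x) (tag y).
Proof.
rewrite -vmulE; have /forallP/(_ x)/forallP/(_ y) := orient_D.
by case: ifP => // _ /negPf ->.
Qed.

Lemma path_tag x p : path (arc D) x p -> path e (tag x) (map tag p).
Proof. by apply: homo_path => ? ?; apply: arc_e. Qed.

(** Walks of the orientation project by [tag] to walks of the tree, so copies of two vertices at
    distance four are no closer. *)
Lemma orientation_diam_ge4 : strong (arc D) -> 4 <= diam (arc D).
Proof.
move=> strong_D; have [x [y dxy]] := far_apart c diam_e.
apply: leq_trans (dist_le_diam (arc D) (copy0 x) (copy0 y)).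
rewrite leqNgt; apply/negP; rewrite ltnS => le3.
have /dist_leP : dist (arc D) (copy0 x) (copy0 y) <= 3 by [].
case; first by apply: ltn_trans card_vtx.
move=> p [/path_tag rp lp sp]; suff: dist e x y <= 3 by rewrite dxy.
apply/dist_leP; first by apply: ltn_trans (card_V c tree_e diam_e).
by exists (map tag p); rewrite size_map -[x in last x]/(tag (copy0 x)) last_map lp.
Qed.

End Orientation.

Lemma in_C0P :
  in_C0 e s <-> exists D : {set vtx * vtx},
    [/\ orientation adj D, strong (arc D) & diam (arc D) <= 4].
Proof.
split=> [[_]|[D [oD sD dD]]].
  rewrite diam_e => /bigminn_attained; case; first exact: card_vtx.
  by move=> D /andP[oD sD] dD; exists D; rewrite dD.
split=> //; rewrite diam_e; apply/eqP; rewrite eqn_leq.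
apply/andP; split; rewrite /orientation_number.
  by apply: leq_trans (bigminn_leq _ _ _) dD; rewrite oD.
apply: (big_ind (fun m => 4 <= m)).
- exact: ltnW card_vtx.
- by move=> a b a4 b4; rewrite leq_min a4.
- by move=> D' /andP[oD' sD']; apply: orientation_diam_ge4.
Qed.

(** * Constraints imposed by an orientation of diameter at most four *)

Section Necessity.
Variable D : {set vtx * vtx}.
Hypothesis orient_D : orientation adj D.
Hypothesis diam_D : diam (arc D) <= 4.

Local Notation r := (arc D).
Local Notation e' := (arc_e orient_D).

Lemma short_walk x y : exists p, [/\ path r x p, last x p = y & size p <= 4].
Proof.
by apply/(dist_leP _ _ _ card_vtx)/(leq_trans (dist_le_diam _ _ _) diam_D).
Qed.

(** By parity, a walk from [x] to [u] of length at most four has length one or three, and it starts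
    with a copy of [j]. Length one would give [tag u = j], and so would length three if the vertex
    before [u] were a copy of a child of [j]; hence it is a copy of the centre. *)
Lemma walk_down x u j : level2 e c (tag x) -> e j (tag x) -> e c (tag u) -> tag u != j ->
  exists a b, [/\ tag a = j, tag b = c, r x a, r a b & r b u].
Proof.
move=> l2x ejx ecu nuj; have [p [rp lp sp]] := short_walk x u.
have ecj := level2_nbr tree_e ecc_c l2x ejx.
have ecx := level2_not_level1 l2x.
have par z : r x z -> tag z = j.
  move=> /e' exz; apply: (level2_unique tree_e ecc_c l2x) => //.
  by rewrite (e_sym tree_e).
have lev z w : r z w -> e c (tag w) = ~~ e c (tag z).
  by move/e'; apply: (e_level tree_e ecc_c).
case: p rp lp sp => [|a [|b [|d [|f [|]]]]] //=.
- by move=> _ xu; rewrite -xu ecx in ecu.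
- by rewrite andbT => /par + au; rewrite au => uj; rewrite uj eqxx in nuj.
- case/and3P => /lev la /lev lb _ bu _.
  by rewrite -bu lb la ecx in ecu.
- case/and4P => xa ab bd _ du _; exists a, b.
  have aj := par _ xa; rewrite -du; split=> //.
  apply/eqP/negPn/negP => nbc; move: nuj; rewrite -du => /negP; apply; apply/eqP.
  have l2b : level2 e c (tag b) by rewrite /level2 nbc (lev _ _ ab) (lev _ _ xa) ecx.
  apply: (level2_unique tree_e ecc_c l2b); first by rewrite (e_sym tree_e) e'.
  by rewrite -aj e'.
- case/and5P => /lev la /lev lb /lev ld /lev lf _ fu _.
  by rewrite -fu lf ld lb la ecx in ecu.
Qed.

Lemma walk_up x u j : level2 e c (tag x) -> e j (tag x) -> e c (tag u) -> tag u != j ->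
  exists a b, [/\ tag a = j, tag b = c, r u b, r b a & r a x].
Proof.
move=> l2x ejx ecu nuj; have [p [rp lp sp]] := short_walk u x.
have ecx := level2_not_level1 l2x.
have par z : r z x -> tag z = j.
  by move=> /e' ezx; apply: (level2_unique tree_e ecc_c l2x).
have lev z w : r z w -> e c (tag w) = ~~ e c (tag z).
  by move/e'; apply: (e_level tree_e ecc_c).
case: p rp lp sp => [|a [|b [|d [|f [|]]]]] //=.
- by move=> _ xu; rewrite xu ecx in ecu.
- by rewrite andbT => + ax; rewrite ax => /par uj; rewrite uj eqxx in nuj.
- case/and3P => /lev la /lev lb _ bx _.
  by move: ecx; rewrite -bx lb la ecu.
- case/and4P => ua ab bd _ dx _; rewrite dx in bd; exists b, a.
  have bj := par _ bd; split=> //.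
  apply/eqP/negPn/negP => nac; move: nuj => /negP; apply; apply/eqP.
  have l2a : level2 e c (tag a) by rewrite /level2 nac (lev _ _ ua) ecu.
  apply: (level2_unique tree_e ecc_c l2a); first by rewrite e'.
  by rewrite -bj (e_sym tree_e) e'.
- case/and5P => /lev la /lev lb /lev ld /lev lf _ fx _.
  by move: ecx; rewrite -fx lf ld lb la ecu.
Qed.

Definition out (u : vtx) : {set 'I_(s c)} := [set i | r u (copy c i)].

(** For a non-leaf neighbour [v] of the centre, some leaf attached to it; [c] is a default value. *)
Definition child v : V := if [pick w | e v w && (w != c)] is Some w then w else c.
Definition end_vertex v : vtx := copy0 (child v).
Definition end_out v : {set 'I_(s v)} := [set t | r (end_vertex v) (copy v t)].

Definition nbrs : {set V} := [set v | e c v].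
Definition inner : {set V} := nbrs :\: leaf_nbrs e c.
Definition Osets v : {set {set 'I_(s c)}} := [set out (copy v t) | t : 'I_(s v)].
Definition Pset v := \bigcup_(t in end_out v) out (copy v t).
Definition Qset v := \bigcap_(t in ~: end_out v) out (copy v t).
Definition one_out := [set v in inner | #|end_out v| == 1].
Definition one_in := [set v in inner | #|~: end_out v| == 1].

Lemma innerP v : v \in inner -> [/\ e c v, e v (child v) & level2 e c (child v)].
Proof.
rewrite in_setD [v \in nbrs]inE => /andP[nl ecv]; move: nl.
rewrite (nonleaf_child tree_e) // /child; case: pickP => [w /andP[evw nw] _|no].
  by split=> //; apply: (child_level2 tree_e ecc_c ecv).
by case/existsP => w; rewrite no.
Qed.

Lemma copy_tag (x : vtx) v : tag x = v -> exists t : 'I_(s v), x = copy v t.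
Proof. by case: x => w t /= <-; exists t. Qed.

Lemma end_arc v t : v \in inner ->
  r (copy v t) (end_vertex v) = (t \notin end_out v).
Proof.
move=> /innerP[ecv evw l2w]; rewrite inE; apply: (orient_arc orient_D).
by rewrite vmulE.
Qed.

Lemma centre_arc v (t : 'I_(s v)) i : e c v -> r (copy c i) (copy v t) = (i \notin out (copy v t)).
Proof. by move=> ecv; rewrite inE; apply: (orient_arc orient_D); rewrite vmulE. Qed.

(** [P_cross] and [Q_cross] are read off the walks of length three between the leaf copy
    [end_vertex j] and a copy of [i], one for each direction. *)
Lemma leaf_system_of_orientation :
  leaf_system nbrs inner one_out one_in Osets Pset Qset.
Proof.
split.
- exact: subsetDl.
- by apply/subsetP => v; rewrite inE => /andP[].
- by apply/subsetP => v; rewrite inE => /andP[].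
- by move=> v _; apply/set0Pn; exists (out (copy0 v)); apply: imset_f.
- move=> i j U jI; rewrite inE => eci nij /imsetP[t _ ->].
  have [ecj ejw l2w] := innerP jI.
  have [a [b [/copy_tag[t' ->] /copy_tag[k ->] xa ab bu]]] :=
    @walk_down (end_vertex j) (copy i t) j l2w ejw eci nij.
  rewrite centre_arc // in bu; apply: contra bu => /subsetP; apply.
  by apply/bigcupP; exists t'; rewrite ?inE.
- move=> i j U jI; rewrite inE => eci nij /imsetP[t _ ->].
  have [ecj ejw l2w] := innerP jI.
  have [a [b [/copy_tag[t' ->] /copy_tag[k ->] ub ba ax]]] :=
    @walk_up (end_vertex j) (copy i t) j l2w ejw eci nij.
  rewrite end_arc // in ax; rewrite centre_arc // in ba.
  apply: contra ba => /subsetP/(_ k); rewrite inE => /(_ ub)/bigcapP; apply.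
  by rewrite inE.
- move=> j; rewrite inE => /andP[_ /cards1P[t et]].
  by rewrite /Pset et big_set1; apply: imset_f.
- move=> j; rewrite inE => /andP[_ /cards1P[t et]].
  by rewrite /Qset et big_set1; apply: imset_f.
- by move=> j Z _ sub; apply/bigcupsP => t _; apply/sub/imset_f.
- by move=> j Z _ sub; apply/bigcapsP => t _; apply/sub/imset_f.
Qed.

Lemma end_out_neq0 v : v \in inner -> 0 < #|end_out v|.
Proof.
move=> vI; have [ecv evw l2w] := innerP vI; apply/card_gt0P.
have [[|a p] [/= rp lp _]] := short_walk (end_vertex v) (copy0 c).
  by move: l2w; rewrite /level2 -[child v]/(tag (end_vertex v)) lp eqxx.
case/andP: rp => xa _; have [|t ea] := @copy_tag a v.
  by apply: (level2_unique tree_e ecc_c l2w); rewrite // (e_sym tree_e) (e' xa).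
by exists t; rewrite inE -ea.
Qed.

Lemma end_in_neq0 v : v \in inner -> 0 < #|~: end_out v|.
Proof.
move=> vI; have [ecv evw l2w] := innerP vI; apply/card_gt0P.
have [p] := short_walk (copy0 c) (end_vertex v).
case/lastP: p => [|p a] [rp lp _].
  by move: l2w; rewrite /level2 -[child v]/(tag (end_vertex v)) -lp eqxx.
move: rp lp; rewrite rcons_path last_rcons => /andP[_ xa] ea; rewrite ea in xa.
have [|t eb] := @copy_tag (last (copy0 c) p) v.
  by apply: (level2_unique tree_e ecc_c l2w); rewrite // (e' xa).
by exists t; rewrite inE -end_arc // -eb.
Qed.

End Necessity.

Lemma inner_split : #|inner| = #|A_eq e s c 2| + #|A_eq e s c 3| + #|A_ge e s c 4|.
Proof.
rewrite -!sum1_card [in RHS]big_mkcond [X in _ + X + _]big_mkcond [X in _ + _ + X]big_mkcond.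
rewrite -!big_split [LHS]big_mkcond; apply: eq_bigr => v _.
rewrite !inE; case: (e c v) => //=; case: (deg e v == 1) => //=.
by have := s_ge2 v; case: (s v) => [|[|[|[|n]]]].
Qed.

Lemma card_nbrs : #|nbrs| = deg e c. Proof. by []. Qed.

Lemma in_A_eq j v : (v \in A_eq e s c j) = (v \in inner) && (s v == j).
Proof. by rewrite !inE; case: (e c v); rewrite ?andbF //= andbT. Qed.

Lemma in_A_ge j v : (v \in A_ge e s c j) = (v \in inner) && (j <= s v).
Proof. by rewrite !inE; case: (e c v); rewrite ?andbF //= andbT. Qed.

(** [A_2] is the intersection of the two families and [A_3] lies in their union, so [2a + b] is at
    most the sum of their sizes. The alternatives are a total at least two below the bound; all
    neighbours of the centre in one family, hence none of them a leaf; and exactly one missing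
    set. *)
Lemma necessity (k := (s c)./2) (C := 'C(s c, uphalf (s c)))
  (a := #|A_eq e s c 2|) (b := #|A_eq e s c 3|) (g := #|A_ge e s c 4|) :
  odd (s c) -> 0 < k -> in_C0 e s ->
  [\/ 2 * a + b + 2 <= 2 * C,
      deg e c = a + b + g /\ deg e c <= C |
      2 * a + b + g + 1 <= 2 * C /\ k * k.+1 <= a].
Proof.
move=> s_odd k_gt0 /in_C0P[D [oD _ dD]].
have sc : s c = k.*2.+1 by rewrite -[LHS]odd_double_half s_odd.
have cT : #|'I_(s c)| = k.*2.+1 by rewrite card_ord.
have eC : #|layer 'I_(s c) k| = C.
  by rewrite (card_layer_middle cT) card_layer card_ord /C uphalf_half s_odd.
have sys := leaf_system_of_orientation oD dD.
have [] := leaf_system_bound cT k_gt0 sys; rewrite !eC.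
set I1 := one_out D in sys *; set I2 := one_in D in sys *.
have eX v : #|end_out D v| + #|~: end_out D v| = s v by rewrite cardsC card_ord.
have inI1 v : (v \in I1) = (v \in inner) && (#|end_out D v| == 1).
  by rewrite [LHS]inE.
have inI2 v : (v \in I2) = (v \in inner) && (#|~: end_out D v| == 1).
  by rewrite [LHS]inE.
have eI : I1 :&: I2 = A_eq e s c 2.
  apply/setP=> v; rewrite in_setI in_A_eq inI1 inI2.
  case: (boolP (v \in inner)) => //= vI; have := eX v.
  have := end_out_neq0 oD dD vI; have := end_in_neq0 oD dD vI.
  by move: #|_| #|_| => m n m0 n0 <-; apply/andP/eqP; lia.
have sU : A_eq e s c 2 :|: A_eq e s c 3 \subset I1 :|: I2.
  apply/subsetP => v; rewrite !in_setU !in_A_eq inI1 inI2 -!andb_orr.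
  case/andP=> vI; rewrite vI /=; have := eX v.
  have := end_out_neq0 oD dD vI; have := end_in_neq0 oD dD vI.
  by move: #|_| #|_| => m n m0 n0 <-; lia.
have dA : A_eq e s c 2 :&: A_eq e s c 3 = set0.
  apply/setP=> v; rewrite in_setI !in_A_eq in_set0.
  by case: eqP => [->|]; rewrite ?andbF.
have cU := subset_leq_card sU; have cUI := cardsUI I1 I2.
have cA := cardsUI (A_eq e s c 2) (A_eq e s c 3).
rewrite dA cards0 addn0 in cA; rewrite cA in cU; rewrite eI in cUI.
rewrite -/a -/b in cU cUI; have split_inner := inner_split; rewrite -/a -/b -/g in split_inner.
have sIn : inner \subset nbrs by apply: subsetDl.
have s1 := I1_NL sys; have s2 := I2_NL sys.
move=> le1 le2 ge12.
have [|lt12] := leqP (2 * a + b + 2) (2 * C); first by constructor 1.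
case: ge12 => [|sN|[sN|[s12 c12 g12]]]; first by lia.
- constructor 2; have eN1 : nbrs = I1.
    by apply/eqP; rewrite eqEsubset sN (subset_trans s1).
  have eNi : nbrs = inner by apply/eqP; rewrite eqEsubset sIn andbT (subset_trans sN).
  by rewrite -split_inner -card_nbrs; split; [rewrite -eNi | rewrite eN1].
- constructor 2; have eN1 : nbrs = I2.
    by apply/eqP; rewrite eqEsubset sN (subset_trans s2).
  have eNi : nbrs = inner by apply/eqP; rewrite eqEsubset sIn andbT (subset_trans sN).
  by rewrite -split_inner -card_nbrs; split; [rewrite -eNi | rewrite eN1].
- constructor 3; rewrite eI -/a in g12; split=> //.
  have := subset_leq_card s12; lia.
Qed.

End Multiplication.

(** * From combinatorial schemes to orientations of diameter four *)

Section Realization.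
Variables (V : finType) (e : rel V) (s : V -> nat) (c : V).
Hypotheses (tree_e : tree e) (diam_e : diam e = 4) (ecc_c : ecc e c = 2).
Hypothesis s_ge2 : forall v, 2 <= s v.

Local Notation vtx := (vmul_vertex s).
Local Notation copy v i := (Tagged (fun v => 'I_(s v)) (i : 'I_(s v)) : vtx).
Local Notation adj := (@vmul V e s).
Local Notation inner := (inner e c).

(* [O v t] is the out-set in the centre class of the [t]-th copy of the
   neighbour [v] of [c]; [h v m t] tells whether the [m]-th copy of any leaf
   attached to [v] points to the [t]-th copy of [v]. *)
Variables (O : V -> nat -> {set 'I_(s c)}) (h : V -> nat -> nat -> bool).

(** Apart from [out_neq0], each field supplies walks of length at most three between a copy of a
    neighbour of the centre and a copy of the centre or of a leaf. A detour uses a centre copy lying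
    in one out-set and not in another, or a leaf copy of index [0] or [1], which exists as
    multiplicities are at least two. *)
Record scheme : Prop := Scheme {
  to_centre : forall v t i, e c v -> t < s v -> i \notin O v t ->
    (exists v' t', [/\ e c v', t' < s v', i \in O v' t' & ~~ (O v t \subset O v' t')]) \/
    (v \in inner /\ exists t', [/\ t' < s v, ~~ h v 0 t, h v 0 t' & i \in O v t']);
  from_centre : forall v t i, e c v -> t < s v -> i \in O v t ->
    (exists v' t', [/\ e c v', t' < s v', i \notin O v' t' & ~~ (O v' t' \subset O v t)]) \/
    (v \in inner /\ exists t', [/\ t' < s v, ~~ h v 0 t', h v 0 t & i \notin O v t']);
  out_neq0 : forall v t, e c v -> t < s v -> O v t != set0;
  end_cross_out : forall v m v' t', v \in inner -> e c v' -> v' != v -> t' < s v' ->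
    exists t, [/\ t < s v, h v m t & ~~ (O v t \subset O v' t')];
  end_cross_in : forall v m v' t', v \in inner -> e c v' -> v' != v -> t' < s v' ->
    exists t, [/\ t < s v, ~~ h v m t & ~~ (O v' t' \subset O v t)];
  end_own_out : forall v m t, v \in inner -> t < s v ->
    h v m t \/ exists t', [/\ t' < s v, h v m t' &
      ~~ (O v t' \subset O v t) \/ exists m', [/\ m' < 2, ~~ h v m' t' & h v m' t]];
  end_own_in : forall v m t, v \in inner -> t < s v ->
    ~~ h v m t \/ exists t', [/\ t' < s v, ~~ h v m t' &
      ~~ (O v t \subset O v t') \/ exists m', [/\ m' < 2, ~~ h v m' t & h v m' t']]
}.

Definition out_copies (x : vtx) : {set vtx} :=
  [set copy c i | i in O (tag x) (tagged x)].

Definition scheme_arc (x y : vtx) : bool :=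
  adj x y &&
  if tag x == c then x \notin out_copies y
  else if tag y == c then y \in out_copies x
  else if e c (tag x) then ~~ h (tag x) (tagged y) (tagged x)
  else h (tag y) (tagged x) (tagged y).

Definition scheme_arcs : {set vtx * vtx} := [set p | scheme_arc p.1 p.2].

Local Notation r := (arc scheme_arcs).

Lemma scheme_arcE x y : r x y = scheme_arc x y.
Proof. by rewrite /arc /= inE. Qed.

Lemma in_out_copies x i : (copy c i \in out_copies x) = (i \in O (tag x) (tagged x)).
Proof.
apply: mem_imset => j j' /eqP; rewrite -tag_eqE /tag_eq /= eqxx /= tagged_asE.
by move/eqP.
Qed.

Lemma nbr_neq_c v : e c v -> (v == c) = false.
Proof. by move/(e_neq tree_e); rewrite eq_sym => /negbTE. Qed.

Lemma arc_out v t i : e c v -> r (copy v t) (copy c i) = (i \in O v t).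
Proof.
move=> ecv; rewrite scheme_arcE /scheme_arc vmulE //= nbr_neq_c // eqxx.
by rewrite (e_sym tree_e) ecv in_out_copies.
Qed.

Lemma arc_in v t i : e c v -> r (copy c i) (copy v t) = (i \notin O v t).
Proof.
by move=> ecv; rewrite scheme_arcE /scheme_arc vmulE //= eqxx ecv in_out_copies.
Qed.

Lemma arc_up v w (m : 'I_(s w)) t : e c v -> e v w -> w != c ->
  r (copy w m) (copy v t) = h v m t.
Proof.
move=> ecv evw nw; rewrite scheme_arcE /scheme_arc vmulE //= (negbTE nw) nbr_neq_c //.
by rewrite (e_sym tree_e) evw (e_level tree_e ecc_c evw) ecv.
Qed.

Lemma arc_down v w (m : 'I_(s w)) t : e c v -> e v w -> w != c ->
  r (copy v t) (copy w m) = ~~ h v m t.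
Proof.
move=> ecv evw nw; rewrite scheme_arcE /scheme_arc vmulE //= (negbTE nw) nbr_neq_c //.
by rewrite evw ecv.
Qed.

Lemma scheme_orientation : orientation adj scheme_arcs.
Proof.
apply/forallP => x; apply/forallP => y; rewrite !scheme_arcE /scheme_arc.
rewrite !vmulE // (e_sym tree_e (tag y)); case exy: (e (tag x) (tag y)) => //=.
have lev := e_level tree_e ecc_c exy.
have nxy := e_neq tree_e exy.
case: (eqVneq (tag x) c) => [xc|nx].
  have -> : (tag y == c) = false by rewrite -xc eq_sym (negbTE nxy).
  by case: (_ \in _).
case: (eqVneq (tag y) c) => [yc|ny]; first by case: (_ \in _).
by rewrite lev; case: (e c (tag x)) => /=; case: (h _ _ _).
Qed.

Hypothesis sch : scheme.

Definition near n (x y : vtx) := exists p, [/\ path r x p, last x p = y & size p <= n].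

Lemma near1 x y : r x y -> near 3 x y.
Proof. by move=> rxy; exists [:: y]; rewrite /= rxy. Qed.

Lemma near3 x a b y : r x a -> r a b -> r b y -> near 3 x y.
Proof. by move=> xa ab bY; exists [:: a; b; y]; rewrite /= xa ab bY. Qed.

Lemma near4 x a y : r x a -> near 3 a y -> near 4 x y.
Proof. by move=> xa [p [rp lp sp]]; exists (a :: p); rewrite /= xa. Qed.

Lemma near34 x y : near 3 x y -> near 4 x y.
Proof. by case=> p [rp lp sp]; exists p; split=> //; apply: leqW. Qed.

Lemma inner_nbr v : v \in inner -> e c v.
Proof. by case/(innerP tree_e ecc_c). Qed.

Lemma inner_child v m : v \in inner -> m < 2 ->
  exists w (j : 'I_(s w)), [/\ e v w, w != c & m = j].
Proof.
case/(innerP tree_e ecc_c) => ecv evw /andP[nw _] m2.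
by exists (child e c v), (Ordinal (leq_trans m2 (s_ge2 _))).
Qed.

Lemma ord_of v t : t < s v -> exists j : 'I_(s v), t = j.
Proof. by move=> lt; exists (Ordinal lt). Qed.

Lemma near_to_centre v (t : 'I_(s v)) i : e c v -> near 3 (copy v t) (copy c i).
Proof.
move=> ecv; case: (boolP (i \in O v t)) => [it|it].
  by apply: near1; rewrite arc_out.
case: (to_centre sch ecv (ltn_ord t) it) => [[v' [t' [ecv' /ord_of[j ->] ij]]]|].
  case/subsetPn => k kt kj.
  by apply: (@near3 _ (copy c k) (copy v' j)); rewrite ?arc_out ?arc_in.
case=> vI [t' [/ord_of[j ->] ht hj ij]].
have [w [m [evw nw em]]] := inner_child vI (isT : 0 < 2).
apply: (@near3 _ (copy w m) (copy v j)).
- by rewrite arc_down // -em.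
- by rewrite arc_up // -em.
- by rewrite arc_out.
Qed.

Lemma near_from_centre v (t : 'I_(s v)) i : e c v -> near 3 (copy c i) (copy v t).
Proof.
move=> ecv; case: (boolP (i \in O v t)) => [it|it]; last first.
  by apply: near1; rewrite arc_in.
case: (from_centre sch ecv (ltn_ord t) it) => [[v' [t' [ecv' /ord_of[j ->] ij]]]|].
  case/subsetPn => k kt kj.
  by apply: (@near3 _ (copy v' j) (copy c k)); rewrite ?arc_out ?arc_in.
case=> vI [t' [/ord_of[j ->] hj ht ij]].
have [w [m [evw nw em]]] := inner_child vI (isT : 0 < 2).
apply: (@near3 _ (copy v j) (copy w m)).
- by rewrite arc_in.
- by rewrite arc_down // -em.
- by rewrite arc_up // -em.
Qed.

Section Leaf.
Variables (v w : V) (m : 'I_(s w)).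
Hypotheses (vI : v \in inner) (evw : e v w) (nw : w != c).
Let ecv := inner_nbr vI.

Lemma near_leaf_out v' (t : 'I_(s v')) : e c v' -> near 3 (copy w m) (copy v' t).
Proof.
case: (eqVneq v' v) t => [->|nv] t ecv'.
  case: (end_own_out sch m vI (ltn_ord t)) => [ht|[t' [/ord_of[j ->] hj]]].
    by apply: near1; rewrite arc_up.
  case=> [/subsetPn[k kj kt]|[m' [m'2 hm' hm'']]].
    by apply: (@near3 _ (copy v j) (copy c k)); [rewrite arc_up | rewrite arc_out | rewrite arc_in].
  have [w' [l [evw' nw' em]]] := inner_child vI m'2.
  apply: (@near3 _ (copy v j) (copy w' l)).
  - by rewrite arc_up.
  - by rewrite arc_down // -em.
  - by rewrite arc_up // -em.
have [t' [/ord_of[j ->] hj /subsetPn[k kj kt]]] :=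
  end_cross_out sch m vI ecv' nv (ltn_ord t).
by apply: (@near3 _ (copy v j) (copy c k)); [rewrite arc_up | rewrite arc_out | rewrite arc_in].
Qed.

Lemma near_leaf_in v' (t : 'I_(s v')) : e c v' -> near 3 (copy v' t) (copy w m).
Proof.
case: (eqVneq v' v) t => [->|nv] t ecv'.
  case: (end_own_in sch m vI (ltn_ord t)) => [ht|[t' [/ord_of[j ->] hj]]].
    by apply: near1; rewrite arc_down.
  case=> [/subsetPn[k kj kt]|[m' [m'2 hm' hm'']]].
    by apply: (@near3 _ (copy c k) (copy v j)); [rewrite arc_out | rewrite arc_in | rewrite arc_down].
  have [w' [l [evw' nw' em]]] := inner_child vI m'2.
  apply: (@near3 _ (copy w' l) (copy v j)).
  - by rewrite arc_down // -em.
  - by rewrite arc_up // -em.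
  - by rewrite arc_down.
have [t' [/ord_of[j ->] hj /subsetPn[k kj kt]]] :=
  end_cross_in sch m vI ecv' nv (ltn_ord t).
by apply: (@near3 _ (copy c k) (copy v j)); [rewrite arc_out | rewrite arc_in | rewrite arc_down].
Qed.

Lemma leaf_has_out : exists2 a, r (copy w m) a & e c (tag a).
Proof.
have [ht|[t' [/ord_of[j ->] hj _]]] := end_own_out sch m vI (s_gt0 s_ge2 v).
  by exists (copy v (Ordinal (s_gt0 s_ge2 v))); rewrite ?arc_up.
by exists (copy v j); rewrite ?arc_up.
Qed.

End Leaf.

Lemma centre_has_out i : exists2 a, r (copy c i) a & e c (tag a).
Proof.
(* Two vertices at distance four are not both the centre, so the centre has a neighbour. *)
have [x [y dxy]] := far_apart c diam_e.
have [v ecv] : exists v, e c v.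
  case: (centre_cover tree_e ecc_c x) => [xc|ex|[p ep _]]; last 2 first.
  - by exists x.
  - by exists p.
  case: (centre_cover tree_e ecc_c y) => [yc|ey|[p ep _]]; last 2 first.
  - by exists y.
  - by exists p.
  have : dist e x y <= 0.
    apply/dist_leP; first by apply: leq_ltn_trans (card_V c tree_e diam_e).
    by exists [::]; rewrite xc yc.
  by rewrite dxy.
pose t := Ordinal (s_gt0 s_ge2 v).
case: (boolP (i \in O v t)) => it; last by exists (copy v t); rewrite ?arc_in.
case: (from_centre sch ecv (ltn_ord t) it) => [[v' [t' [ecv' /ord_of[j ->] ij _]]]|].
  by exists (copy v' j); rewrite ?arc_in.
by case=> vI [t' [/ord_of[j ->] hj _ ij]]; exists (copy v j); rewrite ?arc_in.
Qed.

Lemma vtx_cases (x : vtx) :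
  [\/ exists i, x = copy c i,
      exists v (t : 'I_(s v)), e c v /\ x = copy v t |
      exists v w (m : 'I_(s w)), [/\ v \in inner, e v w, w != c & x = copy w m]].
Proof.
case: x => w m; case: (eqVneq w c) m => [-> m|nw m]; first by constructor 1; exists m.
case: (boolP (e c w)) => [ew|ew]; first by constructor 2; exists w, m.
have [v ecv evw] := @level2_parent _ _ _ tree_e ecc_c w ltac:(by rewrite /level2 nw).
constructor 3; exists v, w, m; split=> //; rewrite in_setD [_ \in nbrs _ _]inE ecv andbT.
by rewrite (nonleaf_child tree_e) //; apply/existsP; exists w; rewrite evw.
Qed.

(** The copies of the neighbours of the centre are one side of a bipartition. Opposite sides are
    joined by walks of length at most three; within a side, one more step suffices. *)
Lemma near_all x y : near 4 x y.
Proof.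
have even_case a z : e c (tag a) -> ~~ e c (tag z) -> near 3 a z.
  case: a => v t /= ecv; case: (vtx_cases z) => [[i ->] _|[v' [t' [ecv' ->]]]|].
  - exact: near_to_centre.
  - by rewrite /= ecv'.
  - by case=> v' [w [m [vI evw nw ->]]] _; exact: (near_leaf_in m vI evw nw t ecv).
case: (vtx_cases x) => [[i ->]|[v [t [ecv ->]]]|[v [w [m [vI evw nw ->]]]]].
- case: (boolP (e c (tag y))) => [ey|ny].
    by case: y ey => v t ecv; apply/near34/near_from_centre.
  have [a ra ea] := centre_has_out i; exact: near4 ra (even_case a y ea ny).
- case: (boolP (e c (tag y))) => [ey|ny]; last exact/near34/even_case.
  have /set0Pn[i it] := out_neq0 sch ecv (ltn_ord t).
  case: y ey => v' t' ecv'; apply: (@near4 _ (copy c i)); first by rewrite arc_out.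
  exact: near_from_centre.
- case: (boolP (e c (tag y))) => [ey|ny].
    by case: y ey => v' t' ecv'; exact: near34 (near_leaf_out m vI evw nw t' ecv').
  have [a ra ea] := leaf_has_out m vI evw nw; exact: near4 ra (even_case a y ea ny).
Qed.

Theorem scheme_in_C0 : in_C0 e s.
Proof.
apply/(in_C0P c tree_e diam_e s_ge2); exists scheme_arcs; split.
- exact: scheme_orientation.
- apply/forallP => x; apply/forallP => y; apply/connectP.
  by have [p [rp <- _]] := near_all x y; exists p.
- apply/bigmax_leqP => x _; apply/bigmax_leqP => y _; apply/dist_leP; last exact: near_all.
  exact: (card_vtx c tree_e diam_e s_ge2).
Qed.

End Realization.

(** * Optimal orientations *)

(* [ThreeOut] and [ThreeIn] are the two roles of a member of [A_3]: its leaf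
   copies have a single out-neighbour, respectively a single in-neighbour. *)
Variant kind := Two | ThreeOut | ThreeIn | Other.

Section Schemes.
Variables (V : finType) (e : rel V) (s : V -> nat) (c : V) (k : nat).
Hypothesis sc : s c = k.*2.+1.
Hypothesis k_gt0 : 0 < k.
Local Notation T := 'I_(s c).
Local Notation inner := (inner e c).
Implicit Types A B R : {set T}.

Let cT : #|T| = k.*2.+1. Proof. by rewrite card_ord. Qed.

Let card_compl_k A : #|A| = k -> #|~: A| = k.+1.
Proof. by move=> cA; rewrite cardsCs setCK cT cA; lia. Qed.

Lemma card_not_subset A B : #|B| < #|A| -> ~~ (A \subset B).
Proof. by rewrite ltnNge; apply: contra => /subset_leq_card. Qed.

Lemma neq_not_subset A B : #|B| = #|A| -> A != B -> ~~ (A \subset B).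
Proof. by move=> cAB; apply: contra => sAB; rewrite eqEcard sAB cAB leqnn. Qed.

Variable kd : V -> kind.
Definition is_out v := if kd v is (Two | ThreeOut) then true else false.
Definition is_in v := if kd v is (Two | ThreeIn) then true else false.

Hypothesis kd_two : forall v, kd v = Two -> s v = 2 /\ v \in inner.
Hypothesis kd_out : forall v, kd v = ThreeOut -> s v = 3 /\ v \in inner.
Hypothesis kd_in : forall v, kd v = ThreeIn -> s v = 3 /\ v \in inner.

(** * Orientation with a [k]-set and its complement set aside *)

Section Slack.
Hypothesis kd_other : forall v, kd v = Other -> v \in inner -> 4 <= s v.
Hypothesis s_ge2 : forall v, 2 <= s v.
Variables (R : {set T}) (f : V -> {set T}).
Hypothesis cR : #|R| = k.
Hypothesis cf : forall v, kd v <> Other -> #|f v| = k.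
Hypothesis f_out : forall v v', is_out v -> is_out v' -> f v = f v' -> v = v'.
Hypothesis f_in : forall v v', is_in v -> is_in v' -> f v = f v' -> v = v'.
Hypothesis fR : forall v v', kd v <> Other -> e c v' -> kd v' <> Two -> f v != R.

(** A single out-neighbour of a leaf copy gets the complement of [f v], a single in-neighbour gets
    [f v]; the other copies alternate between [R] and [~: R]. *)
Definition slack_out v t : {set T} :=
  match kd v, t with
  | Two, 0 | ThreeOut, 0 => ~: f v
  | Two, _ | ThreeIn, 0 => f v
  | _, _ => if odd t then R else ~: R
  end.

(** For kind [Other], copies [0] and [1] are out-neighbours of the leaf and copies [2] and [3]
    in-neighbours, so that both sides hold [R] and its complement. *)
Definition slack_end v (m t : nat) : bool :=
  match kd v with
  | Two | ThreeOut => t == 0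
  | ThreeIn => t != 0
  | Other => t < 2
  end.

Lemma slack_outP v t :
  [\/ kd v <> Two /\ (slack_out v t = R \/ slack_out v t = ~: R),
      is_out v /\ slack_out v t = ~: f v | is_in v /\ slack_out v t = f v].
Proof.
rewrite /slack_out /is_out /is_in; case: (kd v) t => [] [|t].
- by constructor 2.
- by constructor 3.
- by constructor 2.
- by constructor 1; split=> //; case: ifP => _; [left | right].
- by constructor 3.
- by constructor 1; split=> //; case: ifP => _; [left | right].
- by constructor 1; split=> //; right.
- by constructor 1; split=> //; case: ifP => _; [left | right].
Qed.

Lemma is_outN v : is_out v -> kd v <> Other.
Proof. by rewrite /is_out; case: (kd v). Qed.

Lemma is_inN v : is_in v -> kd v <> Other.
Proof. by rewrite /is_in; case: (kd v). Qed.

Lemma slack_card v t : #|slack_out v t| = k \/ #|slack_out v t| = k.+1.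
Proof.
case: (slack_outP v t) => [[_ [->|->]]|[/is_outN/cf cv ->]|[/is_inN/cf cv ->]].
- by left.
- by right; apply: card_compl_k.
- by right; apply: card_compl_k.
- by left.
Qed.

Lemma slack_cross_out v v' t : is_out v -> e c v' -> v' != v ->
  ~~ (~: f v \subset slack_out v' t).
Proof.
move=> ov ecv' nv; have cv := cf (is_outN ov); have ccv := card_compl_k cv.
case: (slack_outP v' t) => [[n2 [->|->]]|[ov' ->]|[/is_inN/cf cv' ->]].
- by apply: card_not_subset; rewrite ccv cR.
- rewrite setCS; apply: neq_not_subset; first by rewrite cv cR.
  by rewrite eq_sym (fR (is_outN ov) ecv' n2).
- rewrite setCS; apply: neq_not_subset; first by rewrite cv (cf (is_outN ov')).
  by apply: contraNneq nv => /(f_out ov' ov) ->.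
- by apply: card_not_subset; rewrite ccv cv'.
Qed.

Lemma slack_cross_in v v' t : is_in v -> e c v' -> v' != v ->
  ~~ (slack_out v' t \subset f v).
Proof.
move=> iv ecv' nv; have cv := cf (is_inN iv).
case: (slack_outP v' t) => [[n2 [->|->]]|[/is_outN/cf cv' ->]|[iv' ->]].
- apply: neq_not_subset; first by rewrite cv cR.
  by rewrite eq_sym (fR (is_inN iv) ecv' n2).
- by apply: card_not_subset; rewrite cv (card_compl_k cR).
- by apply: card_not_subset; rewrite cv (card_compl_k cv').
- apply: neq_not_subset; first by rewrite cv (cf (is_inN iv')).
  by apply: contraNneq nv => /(f_in iv' iv) ->.
Qed.

(** [R] and [~: R] cover the ground set, so no proper subset contains both. A leaf copy with both
    among the out-sets of its out-neighbours thus reaches every copy of the other neighbours. *)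
Lemma half_above A : #|A| < #|T| -> ~~ (R \subset A) \/ ~~ (~: R \subset A).
Proof.
move=> ltA; case: (boolP (R \subset A)) => [sR|]; last by left.
right; apply: contraL ltA => sRC; rewrite -leqNgt -cardsT subset_leq_card //.
by rewrite -(setUCr R) subUset sR.
Qed.

Lemma half_below A : 0 < #|A| -> ~~ (A \subset R) \/ ~~ (A \subset ~: R).
Proof.
move=> A_gt0; case: (boolP (A \subset R)) => [sR|]; last by left.
right; apply: contraL A_gt0 => sRC; rewrite -leqNgt leqn0 cards_eq0 -subset0.
by rewrite -(setICr R) subsetI sR.
Qed.

Let RC : ~~ (R \subset ~: R).
Proof.
have : 0 < #|R| by rewrite cR.
by case/half_below => //; rewrite subxx.
Qed.

Let CR : ~~ (~: R \subset R).
Proof. by apply: card_not_subset; rewrite (card_compl_k cR) cR. Qed.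

Lemma slack_scheme : scheme e slack_out slack_end.
Proof.
have inner_e v : v \in inner -> e c v.
  by rewrite in_setD [_ \in nbrs _ _]inE => /andP[].
have fC v : kd v <> Other -> ~~ (~: f v \subset f v).
  by move=> nv; apply: card_not_subset; rewrite (card_compl_k (cf nv)) cf.
have fneq v : kd v <> Other -> kd v <> Two -> f v != R.
  move=> n1 n2; apply: (fR n1 _ n2); apply: inner_e.
  by case E: (kd v) n1 n2 => // _ _; [case: (kd_out E) | case: (kd_in E)].
have fCR v : kd v <> Other -> ~~ (~: f v \subset R).
  by move=> nv; apply: card_not_subset; rewrite (card_compl_k (cf nv)) cR.
have fCCR v : kd v <> Other -> kd v <> Two -> ~~ (~: f v \subset ~: R).
  move=> n1 n2; rewrite setCS; apply: neq_not_subset; first by rewrite cR cf.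
  by rewrite eq_sym fneq.
have Rf v : kd v <> Other -> kd v <> Two -> ~~ (R \subset f v).
  by move=> n1 n2; apply: neq_not_subset; rewrite ?cR ?cf // eq_sym fneq.
have RCf v : kd v <> Other -> ~~ (~: R \subset f v).
  by move=> nv; apply: card_not_subset; rewrite (card_compl_k cR) cf.
have lt_card v t : #|slack_out v t| < #|T| by rewrite cT; case: (slack_card v t) => ->; lia.
have gt_card v t : 0 < #|slack_out v t| by case: (slack_card v t) => ->; lia.
split.
- move=> v t i ecv ltv; rewrite /slack_out /slack_end.
  case E: (kd v).
  + have [sv vI] := kd_two E; rewrite sv in ltv; case: t ltv => [|[|//]] _ it.
      left; exists v, 1; rewrite E sv; split=> //; last by apply: fC; rewrite E.
      by move: it; rewrite inE negbK.
    by right; split=> //; exists 0; rewrite inE sv.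
  + have [sv vI] := kd_out E; rewrite sv in ltv.
    case: t ltv => [|[|[|//]]] _ it; left.
    (* Every [i] lies in [R] or in its complement, so one of the copies [1] and [2] leads to it. *)
    * case: (boolP (i \in R)) => iR.
        by exists v, 1; rewrite E sv; split=> //=; apply: fCR; rewrite E.
      by exists v, 2; rewrite E sv inE; split=> //=; apply: fCCR; rewrite E.
    * by exists v, 2; rewrite E sv inE.
    * by exists v, 1; rewrite E sv; split=> //=; move: it; rewrite inE negbK.
  + have [sv vI] := kd_in E; rewrite sv in ltv.
    case: t ltv => [|[|[|//]]] _ it.
    * right; split=> //; case: (boolP (i \in R)) => iR.
        by exists 1; rewrite sv.
      by exists 2; rewrite sv inE.
    * by left; exists v, 2; rewrite E sv inE.
    * by left; exists v, 1; rewrite E sv; split=> //=; move: it; rewrite inE negbK.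
  + case: ifP => _ it; left.
      by exists v, 0; rewrite E inE; split=> //; apply: ltnW.
    by exists v, 1; rewrite E; split=> //=; move: it; rewrite inE negbK.
- move=> v t i ecv ltv; rewrite /slack_out /slack_end.
  case E: (kd v).
  + have [sv vI] := kd_two E; rewrite sv in ltv; case: t ltv => [|[|//]] _ it.
      by right; split=> //; exists 1; move: it; rewrite inE.
    left; exists v, 0; rewrite E sv inE negbK; split=> //.
    by apply: fC; rewrite E.
  + have [sv vI] := kd_out E; rewrite sv in ltv.
    case: t ltv => [|[|[|//]]] _ it.
    * right; split=> //; case: (boolP (i \in R)) => iR.
        by exists 2; rewrite sv inE negbK.
      by exists 1; rewrite sv.
    * by left; exists v, 2; rewrite E sv inE negbK.
    * by left; exists v, 1; rewrite E sv; split=> //=; move: it; rewrite inE.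
  + have [sv vI] := kd_in E; rewrite sv in ltv.
    case: t ltv => [|[|[|//]]] _ it; left.
    * case: (boolP (i \in R)) => iR.
        by exists v, 2; rewrite E sv inE negbK; split=> //=; apply: RCf; rewrite E.
      by exists v, 1; rewrite E sv; split=> //=; apply: Rf; rewrite E.
    * by exists v, 2; rewrite E sv inE negbK.
    * by exists v, 1; rewrite E sv; split=> //=; move: it; rewrite inE.
  + case: ifP => _ it; left.
      by exists v, 0; rewrite E inE negbK; split=> //; apply: ltnW.
    by exists v, 1; rewrite E; split=> //=; move: it; rewrite inE.
- by move=> v t _ _; rewrite -card_gt0.
- move=> v m v' t' vI ecv' nv ltv'; case E: (kd v).
  + have [sv _] := kd_two E; exists 0; rewrite sv /slack_end E; split=> //.
    by rewrite {1}/slack_out E; apply: slack_cross_out; rewrite // /is_out E.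
  + have [sv _] := kd_out E; exists 0; rewrite sv /slack_end E; split=> //.
    by rewrite {1}/slack_out E; apply: slack_cross_out; rewrite // /is_out E.
  + have [sv _] := kd_in E; rewrite sv; case: (half_above (lt_card v' t')) => nR.
      by exists 1; rewrite /slack_end {1}/slack_out E.
    by exists 2; rewrite /slack_end {1}/slack_out E.
  + have sv := kd_other E vI; case: (half_above (lt_card v' t')) => nR.
      by exists 1; rewrite /slack_end {1}/slack_out E; split=> //; apply: leq_trans sv.
    by exists 0; rewrite /slack_end {1}/slack_out E; split=> //; apply: leq_trans sv.
- move=> v m v' t' vI ecv' nv ltv'; case E: (kd v).
  + have [sv _] := kd_two E; exists 1; rewrite sv /slack_end E; split=> //.
    by rewrite {2}/slack_out E; apply: slack_cross_in; rewrite // /is_in E.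
  + have [sv _] := kd_out E; rewrite sv; case: (half_below (gt_card v' t')) => nR.
      by exists 1; rewrite /slack_end {2}/slack_out E.
    by exists 2; rewrite /slack_end {2}/slack_out E.
  + have [sv _] := kd_in E; exists 0; rewrite sv /slack_end E; split=> //.
    by rewrite {2}/slack_out E; apply: slack_cross_in; rewrite // /is_in E.
  + have sv := kd_other E vI; case: (half_below (gt_card v' t')) => nR.
      by exists 3; rewrite /slack_end {2}/slack_out E; split=> //; apply: leq_trans sv.
    by exists 2; rewrite /slack_end {2}/slack_out E; split=> //; apply: leq_trans sv.
- move=> v m t vI ltv; rewrite /slack_end /slack_out; case E: (kd v).
  + case: t ltv => [|t] ltv; [by left | right; exists 0; split=> //; first exact: ltnW].
    by left; apply: fC; rewrite E.
  + have [sv _] := kd_out E; rewrite sv in ltv *.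
    case: t ltv => [|[|[|//]]] _; first by left.
      by right; exists 0; split=> //; left; apply: fCR; rewrite E.
    by right; exists 0; split=> //; left; apply: fCCR; rewrite E.
  + have [sv _] := kd_in E; rewrite sv in ltv *.
    case: t ltv => [|t] _; last by left.
    by right; exists 1; split=> //; left; apply: Rf; rewrite E.
  + have [|t2] := ltnP t 2; [by left | right].
    have sv := kd_other E vI; case: ifP => _; [exists 0 | exists 1];
      by split; [apply: leq_trans sv | | left].
- move=> v m t vI ltv; rewrite /slack_end /slack_out; case E: (kd v).
  + have [sv _] := kd_two E; rewrite sv in ltv *.
    case: t ltv => [|t] ltv; last by left.
    by right; exists 1; split=> //; left; apply: fC; rewrite E.
  + have [sv _] := kd_out E; rewrite sv in ltv *.
    case: t ltv => [|t] _; last by left.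
    by right; exists 1; split=> //; left; apply: fCR; rewrite E.
  + have [sv _] := kd_in E; rewrite sv in ltv *.
    case: t ltv => [|[|[|//]]] _; first by left.
      by right; exists 0; split=> //; left; apply: Rf; rewrite E.
    by right; exists 0; split=> //; left; apply: RCf; rewrite E.
  + have [t2|] := ltnP t 2; [right | by left].
    have sv := kd_other E vI; case: ifP => _; [exists 2 | exists 3];
      by split; [apply: leq_trans sv | | left].
Qed.

End Slack.

(** * Orientation with a single [k]-set left over *)

Section Tight.
Hypothesis kd_other : forall v, kd v = Other -> v \notin inner.
Variables (R : {set T}) (f g : V -> {set T}).
Hypothesis cR : #|R| = k.
Hypothesis cf : forall v, is_in v -> #|f v| = k.
Hypothesis cg : forall v, is_out v -> #|g v| = k.+1.
Hypothesis fR : forall v, is_in v -> f v != R.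
Hypothesis f_inj : forall v v', is_in v -> is_in v' -> f v = f v' -> v = v'.
Hypothesis g_inj : forall v v', is_out v -> is_out v' -> g v = g v' -> v = v'.
Hypothesis g_onto : forall A, #|A| = k.+1 -> exists2 v, is_out v & g v = A.
Hypothesis Rg : forall v, kd v = ThreeOut -> ~~ (R \subset g v).
Hypothesis Rf : forall v, kd v = ThreeIn -> k.+2 <= #|R :|: f v|.

(** The complement of [R] is now a value of [g]. So the two outer copies of a vertex with three
    copies share one set and only the middle copy takes [R]. *)
Definition tight_out v t : {set T} :=
  match kd v, t with
  | Two, 0 => g v
  | Two, _ => f v
  | ThreeOut, 1 | ThreeIn, 1 | Other, _ => R
  | ThreeOut, _ => g v
  | ThreeIn, _ => f v
  end.

(* Two leaf copies of different orientation are needed here, since the copies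
   [0] and [2] of a vertex of kind [ThreeOut] or [ThreeIn] have the same
   out-set. *)
Definition tight_end v (m t : nat) : bool :=
  match kd v with
  | Two => t == 0
  | ThreeOut => t == (if m == 0 then 0 else 2)
  | ThreeIn => t != (if m == 0 then 0 else 2)
  | Other => false
  end.

Lemma tight_outP v t :
  [\/ tight_out v t = R, is_out v /\ tight_out v t = g v |
      is_in v /\ tight_out v t = f v].
Proof.
rewrite /tight_out /is_out /is_in; case: (kd v) t => [] [|[|t]];
  by [constructor 1 | constructor 2 | constructor 3].
Qed.

Lemma tight_card v t : k <= #|tight_out v t| <= k.+1.
Proof.
by case: (tight_outP v t) => [->|[/cg cv ->]|[/cf cv ->]]; rewrite ?cR ?cv ?leqnn ?leqnSn.
Qed.

Lemma tight_cross_out v v' t : is_out v -> v' != v -> ~~ (g v \subset tight_out v' t).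
Proof.
move=> ov nv; have cv := cg ov.
case: (tight_outP v' t) => [->|[ov' ->]|[/cf cv' ->]].
- by apply: card_not_subset; rewrite cv cR.
- apply: neq_not_subset; first by rewrite cv cg.
  by apply: contraNneq nv => /(g_inj ov ov') ->.
- by apply: card_not_subset; rewrite cv cv'.
Qed.

Lemma tight_cross_in v v' t : is_in v -> v' != v -> ~~ (tight_out v' t \subset f v).
Proof.
move=> iv nv; have cv := cf iv.
case: (tight_outP v' t) => [->|[/cg cv' ->]|[iv' ->]].
- by apply: neq_not_subset; rewrite ?cv ?cR // eq_sym fR.
- by apply: card_not_subset; rewrite cv cv'.
- apply: neq_not_subset; first by rewrite cv cf.
  by apply: contraNneq nv => /(f_inj iv' iv) ->.
Qed.

Lemma g_nbr v : is_out v -> e c v /\ tight_out v 0 = g v /\ 0 < s v.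
Proof.
rewrite /is_out /tight_out; case E: (kd v) => // _.
  have [-> +] := kd_two E; rewrite in_setD [_ \in nbrs _ _]inE => /andP[_ ->].
  by [].
have [-> +] := kd_out E; rewrite in_setD [_ \in nbrs _ _]inE => /andP[_ ->].
by [].
Qed.

Lemma tight_scheme : scheme e tight_out tight_end.
Proof.
have gf v : is_out v -> is_in v -> ~~ (g v \subset f v).
  by move=> ov iv; apply: card_not_subset; rewrite cf // cg.
have gR v : is_out v -> ~~ (g v \subset R).
  by move=> ov; apply: card_not_subset; rewrite cR cg.
have Rnf v : is_in v -> ~~ (R \subset f v).
  by move=> iv; apply: neq_not_subset; rewrite ?cR ?cf // eq_sym fR.
split.
- move=> v t i ecv ltv it; left.
  have /card_gt0P[x xt] : 0 < #|tight_out v t| by have := tight_card v t; lia.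
  have xi : x != i by apply: contraNneq it => <-.
  (* The set [i |: A] has [k.+1] elements and omits the element [x] of the current out-set; [g_onto]
     makes it an out-set. *)
  have [|A sA cA] := @subset_of_card T k (~: [set x; i]).
    by rewrite cardsCs setCK cards2 xi cT; lia.
  have iA : i \notin A by apply/negP => /(subsetP sA); rewrite !inE eqxx orbT.
  have xA : x \notin A by apply/negP => /(subsetP sA); rewrite !inE eqxx.
  have [|v' ov' gv'] := @g_onto (i |: A); first by rewrite cardsU1 iA cA.
  have [ecv' [e0 sv']] := g_nbr ov'.
  exists v', 0; rewrite e0 gv' !inE eqxx; split=> //.
  by apply/subsetPn; exists x; rewrite // !inE negb_or xi.
- move=> v t i ecv ltv it; left.
  (* A set of size [k.+1] avoiding [i] is not contained in the current out-set, which has at most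
     [k.+1] elements and contains [i]. *)
  have [|A sA cA] := @subset_of_card T k.+1 (~: [set i]).
    by rewrite cardsCs setCK cards1 cT; lia.
  have iA : i \notin A by apply/negP => /(subsetP sA); rewrite !inE eqxx.
  have [v' ov' gv'] := g_onto cA; have [ecv' [e0 sv']] := g_nbr ov'.
  exists v', 0; rewrite e0 gv'; split=> //.
  apply: contra iA => sAt; suff -> : A = tight_out v t by [].
  by apply/eqP; rewrite eqEcard sAt cA; case/andP: (tight_card v t).
- by move=> v t _ _; rewrite -card_gt0; have := tight_card v t; lia.
- move=> v m v' t' vI ecv' nv ltv'; rewrite /tight_end {1}/tight_out; case E: (kd v).
  + have [sv _] := kd_two E; exists 0; rewrite sv; split=> //.
    by apply: tight_cross_out; rewrite // /is_out E.
  + have [sv _] := kd_out E; exists (if m == 0 then 0 else 2); rewrite sv eqxx.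
    have := @tight_cross_out v v' t'; rewrite /is_out E => /(_ isT nv).
    by case: ifP.
  + have [sv _] := kd_in E; rewrite sv.
    (* A set of at most [k.+1] elements cannot contain both [R] and [f v], whose union has at least
       [k.+2]. *)
    case: (boolP (R \subset tight_out v' t')) => [sR|nR].
      exists (if m == 0 then 2 else 0); case: ifP => _; split=> //.
        apply: contraL (Rf E) => sf; rewrite -ltnNge ltnS.
        have /andP[_] := tight_card v' t'; apply: leq_trans.
        by rewrite subset_leq_card // subUset sR.
      apply: contraL (Rf E) => sf; rewrite -ltnNge ltnS.
      have /andP[_] := tight_card v' t'; apply: leq_trans.
      by rewrite subset_leq_card // subUset sR.
    by exists 1; case: ifP.
  + by have := kd_other E; rewrite vI.
- move=> v m v' t' vI ecv' nv ltv'; rewrite /tight_end {2}/tight_out; case E: (kd v).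
  + have [sv _] := kd_two E; exists 1; rewrite sv; split=> //.
    by apply: tight_cross_in; rewrite // /is_in E.
  + have [sv _] := kd_out E; rewrite sv.
    (* An out-set contained in [R] equals [R] by size, and [R] is not contained in [g v]. *)
    case: (boolP (tight_out v' t' \subset R)) => [sR|nR].
      have key : ~~ (tight_out v' t' \subset g v).
        apply: contra (Rg E) => sg; suff <- : tight_out v' t' = R by [].
        by apply/eqP; rewrite eqEcard sR cR; case/andP: (tight_card v' t').
      by exists (if m == 0 then 2 else 0); case: ifP.
    by exists 1; case: ifP.
  + have [sv _] := kd_in E; exists (if m == 0 then 0 else 2); rewrite sv eqxx.
    have := @tight_cross_in v v' t'; rewrite /is_in E => /(_ isT nv).
    by case: ifP.
  + by have := kd_other E; rewrite vI.
- move=> v m t vI ltv; rewrite /tight_end /tight_out; case E: (kd v).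
  + have [sv _] := kd_two E; rewrite sv in ltv *.
    case: t ltv => [|[|//]] _; [by left | right; exists 0; split=> //; left].
    by apply: gf; rewrite /is_out /is_in E.
  + have [sv _] := kd_out E; rewrite sv in ltv *.
    have gRv : ~~ (g v \subset R) by apply: gR; rewrite /is_out E.
    case: (eqVneq m 0) => _; case: t ltv => [|[|[|//]]] _; try by left.
    * by right; exists 0; split=> //; left.
    (* Copies [0] and [2] have the same out-set, so the walk between them passes through the leaf
       copy [1], which is oriented differently. *)
    * by right; exists 0; split=> //; right; exists 1.
    * by right; exists 2; split=> //; right; exists 0.
    * by right; exists 2; split=> //; left.
  + have [sv _] := kd_in E; rewrite sv in ltv *.
    have Rfv : ~~ (R \subset f v) by apply: Rnf; rewrite /is_in E.
    case: (eqVneq m 0) => _; case: t ltv => [|[|[|//]]] _; try by left.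
    * by right; exists 1; split=> //; left.
    * by right; exists 1; split=> //; left.
  + by have := kd_other E; rewrite vI.
- move=> v m t vI ltv; rewrite /tight_end /tight_out; case E: (kd v).
  + have [sv _] := kd_two E; rewrite sv in ltv *.
    case: t ltv => [|[|//]] _; [right; exists 1; split=> //; left | by left].
    by apply: gf; rewrite /is_out /is_in E.
  + have [sv _] := kd_out E; rewrite sv in ltv *.
    have gRv : ~~ (g v \subset R) by apply: gR; rewrite /is_out E.
    case: (eqVneq m 0) => _; case: t ltv => [|[|[|//]]] _; try by left.
    * by right; exists 1; split=> //; left.
    * by right; exists 1; split=> //; left.
  + have [sv _] := kd_in E; rewrite sv in ltv *.
    have Rfv : ~~ (R \subset f v) by apply: Rnf; rewrite /is_in E.
    case: (eqVneq m 0) => _; case: t ltv => [|[|[|//]]] _; try by left.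
    * by right; exists 0; split=> //; left.
    * by right; exists 0; split=> //; right; exists 1.
    * by right; exists 2; split=> //; right; exists 0.
    * by right; exists 2; split=> //; left.
  + by have := kd_other E; rewrite vI.
Qed.

End Tight.
End Schemes.

(** * Extending injections between finite sets *)

Section Injections.
Variables (X Y : finType).
Implicit Types (A B : {set X}) (S : {set Y}) (f : X -> Y).

Lemma injection_extend A B S f :
  {in A &, injective f} -> (forall x, x \in A -> f x \in S) ->
  [disjoint A & B] -> #|A| + #|B| <= #|S| ->
  exists g, [/\ {in A, g =1 f}, {in A :|: B &, injective g} &
    forall x, x \in A :|: B -> g x \in S].
Proof.
move=> f_inj fS dAB leS; pose S' := S :\: f @: A.
have leS' : #|B| <= #|S'|.
  have sfS : f @: A \subset S by apply/subsetP => _ /imsetP[x xA ->]; apply: fS.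
  have := cardsID (f @: A) S; rewrite (setIidPr sfS) card_in_imset // -/S'; lia.
have idx x : x \in B -> index x (enum B) < size (enum S').
  move=> xB; apply: leq_trans (_ : size (enum B) <= _); last by rewrite -!cardE.
  by rewrite index_mem mem_enum.
pose g x := if x \in B then nth (f x) (enum S') (index x (enum B)) else f x.
have gA x : x \in A -> g x = f x by move=> xA; rewrite /g (disjointFr dAB xA).
have gB x : x \in B -> g x \in S'.
  by move=> xB; rewrite /g xB -mem_enum mem_nth // idx.
have gAB x y : x \in A -> y \in B -> g x <> g y.
  move=> xA /gB; rewrite inE => /andP[+ _] eg; rewrite -eg gA // => /negP; apply.
  exact: imset_f.
exists g; split=> //.
  move=> x y; rewrite !in_setU => /orP[xA|xB] /orP[yA|yB] eg.
  - by apply: f_inj; rewrite // -!gA.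
  - by case: (gAB x y xA yB).
  - by case: (gAB y x yA xB).
  - move: eg; rewrite /g xB yB (set_nth_default (f x) (f y)) ?idx // => /eqP.
    rewrite nth_uniq ?enum_uniq ?idx // => /eqP ei.
    by rewrite -(@nth_index _ x x (enum B)) ?mem_enum // ei nth_index ?mem_enum.
move=> x; rewrite in_setU => /orP[xA|/gB]; first by rewrite gA // fS.
by rewrite inE => /andP[].
Qed.

Lemma injection_exists A S :
  #|A| <= #|S| -> 0 < #|S| ->
  exists f, {in A &, injective f} /\ forall x, x \in A -> f x \in S.
Proof.
move=> leS /card_gt0P[y _].
have [||||f [_ fi fS]] := @injection_extend set0 A S (fun=> y).
- by move=> x; rewrite inE.
- by move=> x; rewrite inE.
- by rewrite disjoint_sym disjoints_subset setC0 subsetT.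
- by rewrite cards0.
by rewrite set0U in fi fS; exists f.
Qed.

Lemma injection_full A S f :
  {in A &, injective f} -> (forall x, x \in A -> f x \in S) -> #|S| <= #|A| ->
  f @: A = S.
Proof.
move=> f_inj fS leS; apply/eqP; rewrite eqEcard card_in_imset // leS andbT.
by apply/subsetP => _ /imsetP[x xA ->]; apply: fS.
Qed.

End Injections.

(** * Choice of the out-sets under the cardinality conditions *)

Section Sufficiency.
Variables (V : finType) (e : rel V) (s : V -> nat) (c : V) (k : nat).
Hypotheses (tree_e : tree e) (diam_e : diam e = 4) (ecc_c : ecc e c = 2).
Hypothesis s_ge2 : forall v, 2 <= s v.
Hypothesis sc : s c = k.*2.+1.
Hypothesis k_gt0 : 0 < k.
Local Notation T := 'I_(s c).
Local Notation inner := (inner e c).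
Local Notation A2 := (A_eq e s c 2).
Local Notation A3 := (A_eq e s c 3).
Local Notation C := 'C(k.*2.+1, k).

Let cT : #|T| = k.*2.+1. Proof. by rewrite card_ord. Qed.

Let card_L : #|layer T k| = C. Proof. by rewrite card_layer cT. Qed.

Lemma disjoint_A23 : [disjoint A2 & A3].
Proof.
rewrite -setI_eq0; apply/eqP/setP=> v; rewrite in_setI !in_A_eq in_set0.
by case: eqP => [->|]; rewrite ?andbF.
Qed.

Section Kinds.
Variable B1 : {set V}.
Hypothesis B1_A3 : B1 \subset A3.

Definition kind_of v :=
  if v \in A2 then Two else if v \in B1 then ThreeOut
  else if v \in A3 then ThreeIn else Other.

Lemma kind_two v : kind_of v = Two -> s v = 2 /\ v \in inner.
Proof.
rewrite /kind_of; case: ifP => [|_]; last by do 2?case: ifP.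
by rewrite in_A_eq => /andP[? /eqP].
Qed.

Lemma kind_out v : kind_of v = ThreeOut -> s v = 3 /\ v \in inner.
Proof.
rewrite /kind_of; case: ifP => // _; case: ifP => [/(subsetP B1_A3)|_]; last by case: ifP.
by rewrite in_A_eq => /andP[? /eqP].
Qed.

Lemma kind_in v : kind_of v = ThreeIn -> s v = 3 /\ v \in inner.
Proof.
rewrite /kind_of; do 2![case: ifP => // _]; case: ifP => //.
by rewrite in_A_eq => /andP[? /eqP].
Qed.

Lemma kind_other v : kind_of v = Other -> v \in inner -> 4 <= s v.
Proof.
clear B1_A3; rewrite /kind_of; case: ifP => // n2; case: ifP => // _; case: ifP => // n3 _ vI.
by move: n2 n3; rewrite !in_A_eq vI /=; have := s_ge2 v; lia.
Qed.

Lemma is_out_kind v : is_out kind_of v = (v \in A2 :|: B1).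
Proof.
rewrite /is_out /kind_of in_setU; case: (v \in A2) => //=.
by case: (v \in B1) => //; case: (v \in A3).
Qed.

Lemma is_in_kind v : is_in kind_of v = (v \in A2 :|: (A3 :\: B1)).
Proof.
rewrite /is_in /kind_of in_setU in_setD; case: (v \in A2) => //=.
by case: (v \in B1) => //; case: (v \in A3).
Qed.

Lemma kind_neq_other v : kind_of v <> Other -> is_out kind_of v \/ is_in kind_of v.
Proof. by rewrite /is_out /is_in; case: (kind_of v) => //; [left|left|right]. Qed.

End Kinds.

(** Without [R] the [k]-layer keeps [C - 1] sets. They are distributed injectively twice, over [A2]
    with [B1] and over [A2] with the rest of [A3]; the hypothesis makes both fit. *)
Lemma slack_suff : 2 * #|A2| + #|A3| + 2 <= 2 * C -> in_C0 e s.
Proof.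
move=> leC; have [R cR] : exists R : {set T}, #|R| = k := exists_middle cT.
pose S := layer T k :\ R.
have cS : #|S|.+1 = C by rewrite -card_L (cardsD1 R (layer T k)) inE cR eqxx.
(* As many members of [A3] as fit beside [A2] get the role [ThreeOut]. *)
have [|B1 sB1 cB1] := @subset_of_card V (minn #|A3| (C - 1 - #|A2|)) A3.
  exact: geq_minl.
have cB2 := cardsID B1 A3; rewrite (setIidPr sB1) cB1 in cB2.
have dB1 : [disjoint A2 & B1] by apply: disjointWr sB1 disjoint_A23.
have dB2 : [disjoint A2 & A3 :\: B1] by apply: disjointWr (subsetDl _ _) disjoint_A23.
have geC := exchanges_bound cT.
have [||f0 [f0i f0S]] := @injection_exists V _ A2 S; [lia|nia|].
have [|f1 [f1f f1i f1S]] := injection_extend f0i f0S dB1; first by lia.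
have [|f2 [f2f f2i f2S]] := injection_extend f0i f0S dB2; first by lia.
(* Both extensions agree with [f0] on [A2], so one function serves the two roles. *)
pose f v := if v \in B1 then f1 v else f2 v.
have ff1 v : v \in A2 :|: B1 -> f v = f1 v.
  rewrite /f in_setU; case: ifP => //; rewrite orbF => _ vA.
  by rewrite f1f ?f2f.
have ff2 v : v \in A2 :|: (A3 :\: B1) -> f v = f2 v.
  rewrite /f in_setU in_setD; case: ifP => //; rewrite orbF => _ vA.
  by rewrite f1f ?f2f.
have fS v : kind_of B1 v <> Other -> f v \in S.
  case/kind_neq_other; rewrite ?is_out_kind ?is_in_kind => vA.
    by rewrite ff1 // f1S.
  by rewrite ff2 // f2S.
apply: (scheme_in_C0 tree_e diam_e ecc_c s_ge2).
apply: (@slack_scheme V e s c k sc k_gt0 (kind_of B1) _ _ _ _ s_ge2 R f cR).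
- exact: kind_two.
- exact: kind_out.
- exact: kind_in.
- exact: kind_other.
- by move=> v /fS; rewrite !inE => /andP[_ /eqP].
- move=> v v'; rewrite !is_out_kind => vA v'A; rewrite !ff1 //; exact: f1i.
- move=> v v'; rewrite !is_in_kind => vA v'A; rewrite !ff2 //; exact: f2i.
- by move=> v v' /fS; rewrite !inE => /andP[].
Qed.

(** Every neighbour of the centre has kind [Two], so none of its copies takes the spare sets [R] and
    [~: R], and [f] may use the whole [k]-layer. *)
Lemma all_two_suff : #|A2| = deg e c -> #|A2| <= C -> in_C0 e s.
Proof.
move=> aN leC; have [R cR] : exists R : {set T}, #|R| = k := exists_middle cT.
have sA2 : A2 \subset nbrs e c.
  by apply/subsetP => v; rewrite in_A_eq in_setD => /andP[/andP[_ ->]].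
have eN : nbrs e c = A2 by apply/esym/eqP; rewrite eqEcard sA2 aN leqnn.
have [||f [fi fL]] := @injection_exists V _ A2 (layer T k); rewrite ?card_L //.
  by rewrite bin_gt0; lia.
have kT v : kind_of set0 v <> Other -> v \in A2.
  have s3 v' : v' \in A3 -> v' \in A2.
    by rewrite -eN in_A_eq in_setD => /andP[/andP[_ ->]].
  rewrite /kind_of; case: ifP => // n2; rewrite inE; case: ifP => // v3.
  by rewrite (s3 v v3) in n2.
have tN v : e c v -> kind_of set0 v = Two.
  by move=> ecv; rewrite /kind_of -eN inE ecv.
apply: (scheme_in_C0 tree_e diam_e ecc_c s_ge2).
apply: (@slack_scheme V e s c k sc k_gt0 (kind_of set0) _ _ _ _ s_ge2 R f cR).
- exact: kind_two.
- exact/kind_out/sub0set.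
- exact: kind_in.
- exact: kind_other.
- by move=> v /kT/fL; rewrite inE => /eqP.
- by move=> v v' /is_outN/kT vA /is_outN/kT v'A; apply: fi.
- by move=> v v' /is_inN/kT vA /is_inN/kT v'A; apply: fi.
- by move=> v v' _ /tN.
Qed.

(** The count makes [g] a bijection from [A2] with [B1] onto layer [k.+1], and [f] one from [A2]
    with the rest of [A3] onto the [k]-layer without [R]. The values forbidden to members of [A3],
    supersets of [R] for [g] and exchanges of [R] for [f], are all given to [A2]. *)
Lemma tight_suff :
  2 * #|A2| + #|A3| + 1 = 2 * C -> #|A_ge e s c 4| = 0 -> k * k.+1 <= #|A2| ->
  in_C0 e s.
Proof.
move=> eqC A4 leA2; have [R cR] : exists R : {set T}, #|R| = k := exists_middle cT.
pose S := layer T k :\ R.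
have cS : #|S|.+1 = C by rewrite -card_L (cardsD1 R (layer T k)) inE cR eqxx.
have [|B1 sB1 cB1] := @subset_of_card V (C - #|A2|) A3; first by lia.
have cB2 := cardsID B1 A3; rewrite (setIidPr sB1) cB1 in cB2.
have dB1 : [disjoint A2 & B1] by apply: disjointWr sB1 disjoint_A23.
have dB2 : [disjoint A2 & A3 :\: B1] by apply: disjointWr (subsetDl _ _) disjoint_A23.
have cX : #|exchanges R| = k * k.+1.
  by rewrite card_exchanges cR cT; congr (_ * _); lia.
(* [A'] is to receive exactly the exchanges of [R] as values of [f]. *)
have [A' sA' cA'] := subset_of_card leA2.
have [||f0 [f0i f0X]] := @injection_exists V _ A' (exchanges R).
- by rewrite cX cA'.
- by rewrite cX; nia.
have XS v : v \in A' -> f0 v \in S.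
  by move/f0X/exchangesP; rewrite cR => -[cv nv _]; rewrite !inE nv cv eqxx.
pose B := (A2 :\: A') :|: (A3 :\: B1).
have cB : #|A'| + #|B| = C - 1.
  have := cardsID A' A2; rewrite (setIidPr sA').
  have := cardsUI (A2 :\: A') (A3 :\: B1).
  rewrite (_ : _ :&: _ = set0) ?cards0; last first.
    apply/eqP; rewrite setI_eq0; exact: disjointWl (subsetDl _ _) dB2.
  rewrite -/B; lia.
have dB : [disjoint A' & B].
  rewrite -setI_eq0; apply/eqP/setP => v; rewrite in_set0 in_setI.
  case: (boolP (v \in A')) => //= vA.
  by rewrite /B in_setU (disjointFr dB2 (subsetP sA' v vA)) in_setD vA.
have eAB : A' :|: B = A2 :|: (A3 :\: B1).
  by rewrite /B setUA -{1}(setIidPr sA') setID.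
have [|f [ff0 fi fS]] := injection_extend f0i XS dB; first by lia.
rewrite eAB in fi fS.
have fX : f0 @: A' = exchanges R by apply: injection_full; rewrite // cX cA'.
(* There are [k.+1] supersets of [R] of size [k.+1], and [k.+1 <= k * k.+1] because [k] is
   positive. *)
have leA2' : k.+1 <= #|A2| by apply: leq_trans leA2; nia.
have [A'' sA'' cA''] := subset_of_card leA2'.
have cU : #|upshadow [set R]| = k.+1 by rewrite card_upshadow1 cT cR; lia.
have [||g0 [g0i g0U]] := @injection_exists V _ A'' (upshadow [set R]).
- by rewrite cU cA''.
- by rewrite cU.
have UL v : v \in A'' -> g0 v \in layer T k.+1.
  by case/g0U/upshadowP => A /set1P-> [_]; rewrite inE cR => ->.
pose B' := (A2 :\: A'') :|: B1.
have cB' : #|A''| + #|B'| = C.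
  have := cardsID A'' A2; rewrite (setIidPr sA'').
  have := cardsUI (A2 :\: A'') B1.
  rewrite (_ : _ :&: _ = set0) ?cards0; last first.
    apply/eqP; rewrite setI_eq0; exact: disjointWl (subsetDl _ _) dB1.
  rewrite -/B'; lia.
have dB' : [disjoint A'' & B'].
  rewrite -setI_eq0; apply/eqP/setP => v; rewrite in_set0 in_setI.
  case: (boolP (v \in A'')) => //= vA.
  by rewrite /B' in_setU (disjointFr dB1 (subsetP sA'' v vA)) in_setD vA.
have eAB' : A'' :|: B' = A2 :|: B1.
  by rewrite /B' setUA -{1}(setIidPr sA'') setID.
have cL1 : #|layer T k.+1| = C by rewrite -(card_layer_middle cT).
have [|g [gg0 gi gL]] := injection_extend g0i UL dB'; first by rewrite cL1 cB'.
have gfull : g @: (A'' :|: B') = layer T k.+1.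
  apply: injection_full => //; rewrite cL1 -cB'.
  by have := cardsUI A'' B'; rewrite (eqP (_ : _ :&: _ == set0)) ?setI_eq0 // cards0 addn0 => ->.
have gU : g0 @: A'' = upshadow [set R] by apply: injection_full; rewrite // cU cA''.
rewrite eAB' in gi gL gfull.
apply: (scheme_in_C0 tree_e diam_e ecc_c s_ge2).
apply: (@tight_scheme V e s c k sc k_gt0 (kind_of B1) _ _ _ _ R f g cR).
- exact: kind_two.
- exact: kind_out.
- exact: kind_in.
- move=> v /kind_other ge4; apply/negP => vI.
  by have /cards0_eq/setP/(_ v) := A4; rewrite in_A_ge vI ge4 // in_set0.
- by move=> v; rewrite is_in_kind => /fS; rewrite !inE => /andP[_ /eqP].
- by move=> v; rewrite is_out_kind => /gL; rewrite !inE => /eqP.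
- by move=> v; rewrite is_in_kind => /fS; rewrite !inE => /andP[].
- by move=> v v'; rewrite !is_in_kind; apply: fi.
- by move=> v v'; rewrite !is_out_kind; apply: gi.
- move=> A cA; have : A \in layer T k.+1 by rewrite inE cA.
  by rewrite -gfull => /imsetP[v vA ->]; exists v; rewrite // is_out_kind.
(* If [R] were contained in [g v], this value would already belong to a member of [A2], against
   injectivity. *)
- move=> v kv; have ov : v \in A2 :|: B1 by rewrite -is_out_kind /is_out kv.
  have v2 : v \notin A2 by move: kv; rewrite /kind_of; case: ifP.
  have /eqP gv : #|g v| == k.+1 by have := gL v ov; rewrite inE.
  apply: contra v2 => sR; have : g v \in upshadow [set R].
    by apply/upshadowP; exists R; rewrite ?set11 // sR gv cR.
  rewrite -gU => /imsetP[u uA eu]; have uA2 := subsetP sA'' _ uA.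
  suff -> : v = u by [].
  by apply: gi; rewrite // ?in_setU ?uA2 // eu gg0.
- move=> v kv; have iv : v \in A2 :|: (A3 :\: B1) by rewrite -is_in_kind /is_in kv.
  have v2 : v \notin A2 by move: kv; rewrite /kind_of; case: ifP.
  have := fS v iv; rewrite !inE => /andP[nR /eqP cv].
  have nU : #|R :|: f v| != k.+1.
    apply: contra v2 => /eqP cRU; have : f v \in exchanges R.
      by apply/exchangesP; rewrite cR cv cRU.
    rewrite -fX => /imsetP[u uA eu]; have uA2 := subsetP sA' _ uA.
    suff -> : v = u by [].
    by apply: fi; rewrite // ?in_setU ?uA2 // eu ff0.
  have : k < #|R :|: f v|.
    rewrite ltnNge; apply: contra nR => leU.
    have eR : R = R :|: f v by apply/eqP; rewrite eqEcard subsetUl cR.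
    by rewrite eqEcard cv cR leqnn andbT eR subsetUr.
  by rewrite leq_eqVlt eq_sym (negbTE nU).
Qed.

End Sufficiency.

(** * Numerical comparison of the necessary and sufficient conditions *)

Unset Implicit Arguments.

Theorem theorem1p9 (V : finType) (e : rel V) (s : V -> nat) (c : V)
  (tree_e : tree e) (diam_e : diam e = 4) (ecc_c : ecc e c = 2)
  (s_ge2 : forall v, 2 <= s v)
  (sc_ge3 : 3 <= s c) (sc_odd : odd (s c)) :
  (* (1) *)
  (#|A_eq e s c 2| = 0 -> 1 <= #|A_eq e s c 3| -> 0 <= #|A_ge e s c 4| ->
     (in_C0 e s <->
        #|A_eq e s c 3| <= 2 * 'C(s c, uphalf (s c)) - 2)) /\
  (* (2) *)
  (#|A_eq e s c 2| = 0 -> #|A_eq e s c 3| = 0 -> 2 <= #|A_ge e s c 4| ->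
     in_C0 e s) /\
  (* (3) *)
  (2 <= #|A_eq e s c 2| -> #|A_eq e s c 3| = 0 -> #|A_ge e s c 4| = 0 ->
     (in_C0 e s <->
        (#|A_eq e s c 2| < deg e c ->
           #|A_eq e s c 2| <= 'C(s c, uphalf (s c)) - 1) /\
        (#|A_eq e s c 2| = deg e c ->
           #|A_eq e s c 2| <= 'C(s c, uphalf (s c))))) /\
  (* (4) *)
  (1 <= #|A_eq e s c 2| -> #|A_eq e s c 3| = 0 -> 1 <= #|A_ge e s c 4| ->
     (in_C0 e s <-> #|A_eq e s c 2| <= 'C(s c, uphalf (s c)) - 1)) /\
  (* (5) *)
  (1 <= #|A_eq e s c 2| -> #|A_eq e s c 3| = 1 -> #|A_ge e s c 4| = 0 ->
     (in_C0 e s <-> #|A_eq e s c 2| <= 'C(s c, uphalf (s c)) - 1)) /\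
  (* (6) *)
  (1 <= #|A_eq e s c 2| -> 2 <= #|A_eq e s c 3| -> #|A_ge e s c 4| = 0 ->
     (in_C0 e s <->
        (2 * #|A_eq e s c 2| + #|A_eq e s c 3|
           <= 2 * 'C(s c, uphalf (s c)) - 2) \/
        [/\ 2 * #|A_eq e s c 2| + #|A_eq e s c 3|
              = 2 * 'C(s c, uphalf (s c)) - 1,
            uphalf (s c) * (s c)./2 <= #|A_eq e s c 2|
          & 5 <= s c])) /\
  (* (7) *)
  (1 <= #|A_eq e s c 2| -> #|A_eq e s c 3| = 1 -> 1 <= #|A_ge e s c 4| ->
     (in_C0 e s <-> #|A_eq e s c 2| <= 'C(s c, uphalf (s c)) - 2)) /\
  (* (8) *)
  (1 <= #|A_eq e s c 2| -> 2 <= #|A_eq e s c 3| -> 1 <= #|A_ge e s c 4| ->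
     (in_C0 e s <->
        2 * #|A_eq e s c 2| + #|A_eq e s c 3|
          <= 2 * 'C(s c, uphalf (s c)) - 2)).
Proof.
set k := (s c)./2; set C := 'C(s c, uphalf (s c)); set d := deg e c.
have k_gt0 : 0 < k by rewrite /k; lia.
have sc : s c = k.*2.+1 by rewrite -[LHS]odd_double_half sc_odd.
have uh : uphalf (s c) = k.+1 by rewrite uphalf_half sc_odd.
have eC : 'C(k.*2.+1, k) = C.
  by rewrite /C uh sc -bin_sub; [congr 'C(_, _); lia | lia].
have nec := @necessity V e s c tree_e diam_e ecc_c s_ge2 sc_odd k_gt0.
have slack := @slack_suff V e s c k tree_e diam_e ecc_c s_ge2 sc k_gt0.
have all_two := @all_two_suff V e s c k tree_e diam_e ecc_c s_ge2 sc k_gt0.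
have tight := @tight_suff V e s c k tree_e diam_e ecc_c s_ge2 sc k_gt0.
have geC := @exchanges_bound 'I_(s c) k (etrans (card_ord _) sc).
have le_d : #|inner e c| <= d by apply: subset_leq_card; apply: subsetDl.
rewrite (inner_split e c s_ge2) in le_d.
(* Needed to obtain [5 <= s c] in the sixth item. *)
have k1 : k = 1 -> C = 3 by move=> k1; rewrite -eC k1.
rewrite -/k -/C -/d in nec; rewrite -/d eC in all_two; rewrite !eC in slack tight geC.
rewrite uh.
have s5 : (5 <= s c) = (1 < k) by rewrite sc; lia.
rewrite s5; clear eC s5 uh sc sc_ge3 sc_odd.
move: #|A_eq e s c 2| #|A_eq e s c 3| #|A_ge e s c 4| nec slack all_two tight le_d.
move: (in_C0 e s) => P; clearbody k C d => a b g nec slack all_two tight le_d.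
have big : 2 * k <= k * k.+1 by nia.
(* Both orders of the product become the variable [K], leaving only linear arithmetic. *)
move: (k * k.+1) (mulnC k k.+1) big nec tight geC => K <- big nec tight geC.
clear tree_e diam_e ecc_c s_ge2 e s c V.
split; [|split; [|split; [|split; [|split; [|split; [|split]]]]]].
- move=> a0 b1 _; split=> [/nec|leb]; last by apply: slack; lia.
  by case=> [|[]|[]]; lia.
- by move=> a0 b0 _; apply: slack; lia.
- move=> a2 b0 g0; split=> [/nec|[lt_d eq_d]].
    by case=> [|[]|[]]; lia.
  have [eqd|ned] := eqVneq a d; first by apply: all_two => //; apply: eq_d.
  by apply: slack; lia.
- move=> a1 b0 g1; split=> [/nec|leb]; last by apply: slack; lia.
  by case=> [|[]|[]]; lia.
- move=> a1 b1 g0; split=> [/nec|leb]; first by case=> [|[]|[]]; lia.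
  have [lea|gta] := leqP (2 * a + b + 2) (2 * C); first exact: slack.
  (* Here [b = 1] forces [a = C - 1], and [geC] gives [K <= a]. *)
  by apply: tight; lia.
- move=> a1 b2 g0; split=> [/nec|[leb|[eqb ge_a _]]]; last 2 first.
  + by apply: slack; lia.
  + by apply: tight; lia.
  case=> [|[]|[]]; [by lia|by lia|].
  move=> le ge_a; have [?|?] := leqP (2 * a + b + 2) (2 * C); first by left; lia.
  right; split; [lia|lia|].
  (* For [k = 1] one has [2 * a + b = 5] with [b >= 2], hence [a <= 1], whereas [a >= K >= 2]. *)
  by rewrite ltnNge; apply/negP => k_le1; have := k1 ltac:(lia); lia.
- move=> a1 b1 g1; split=> [/nec|leb]; last by apply: slack; lia.
  by case=> [|[]|[]]; lia.
- move=> a1 b2 g1; split=> [/nec|leb]; last by apply: slack; lia.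
  by case=> [|[]|[]]; lia.
Qed.
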